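(* There exist an absolute constant $C>0$ and a bandit algorithm $\mathbb{A}$, which takes as input the time horizon $T$, the number of arms $K$ and the parameter $\rho$ (and has no knowledge of the reward distributions, means or gaps), such that for every integer $T\ge 2$, every integer $K\ge 1$ and every $\rho\in(0,1]$ the following hold. (i) $\mathbb{A}$ is $\rho$-replicable in the stochastic $K$-armed bandit setting with horizon $T$. (ii) For every choice of reward distributions of the $K$ arms, with gaps $(\Delta_j)_{j\in[K]}$, the expected regret satisfies $$\mathbf{E}[R_T]\le C\cdot\frac{K^2}{\rho^2}\sum_{j:\Delta_j>0}\left(\Delta_j+\frac{\log(KT\log(T))}{\Delta_j}\right).$$ (iii) The running time of $\mathbb{A}$ is polynomial in $K$, $T$ and $1/\rho$.
   Context: Stochastic $K$-armed bandit: there is a set of arms $[K]=\{1,\dots,K\}$; each arm $a$ has a fixed unknown reward distribution $\mathcal{D}_a$ supported on $[0,1]$, with mean $\mu_a$. In each round $t=1,\dots,T$ the player pulls an arm $a_t$ and observes a reward $r_t\sim\mathcal{D}_{a_t}$, drawn independently of everything else. A bandit algorithm $\mathbb{A}$ chooses $a_t=\mathbb{A}(a_1,r_1,\dots,a_{t-1},r_{t-1};\xi)$ as a function of the past arm-reward pairs and of internal randomness $\xi$ (which is independent of the rewards). Gaps: $\Delta_j=\max_{a\in[K]}\mu_a-\mu_j$. Expected regret: $\mathbf{E}[R_T]=T\max_{a\in[K]}\mu_a-\mathbf{E}\left[\sum_{t=1}^T\mu_{a_t}\right]$. Replicability: for $\rho\in[0,1]$, $\mathbb{A}$ is $\rho$-replicable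 if, for any reward distributions $(\mathcal{D}_a)_{a\in[K]}$ over $[0,1]$, and for two executions of $\mathbb{A}$ that share the same internal randomness $\xi$ but have independent reward realizations $r^{(1)},r^{(2)}$, $$\Pr_{\xi,r^{(1)},r^{(2)}}\left[(a_1^{(1)},\dots,a_T^{(1)})=(a_1^{(2)},\dots,a_T^{(2)})\right]\ge 1-\rho,$$ where $a_t^{(i)}$ is the arm pulled at round $t$ in execution $i$. $\log$ is the natural logarithm. Running time counts elementary operations (arithmetic operations and comparisons on real numbers, and draws of internal random numbers). *)

(* Defs.v *)
From mathcomp Require Import all_boot all_order all_algebra.
From mathcomp Require Import all_classical all_reals all_analysis.

Set Implicit Arguments.
Unset Strict Implicit.
Unset Printing Implicit Defensive.
Import Order.TTheory GRing.Theory Num.Theory numFieldNormedType.Exports.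
Local Open Scope classical_set_scope.
Local Open Scope ring_scope.

(** * Bandit algorithms

    Arms are the elements of ['I_K] and rounds are numbered from 0. The
    internal randomness [xi : nat -> R] is an unbounded supply of independent
    draws, uniform on [0, 1] (see [bandit_model]). *)

Section Algorithms.
Context {R : realType} {K : nat}.

Definition policy := seq ('I_K * R) -> (nat -> R) -> 'I_K.

(* The sigma-algebra generated by the coordinates of a pair of sequences
   (internal draws, observed rewards). *)
Definition cylinder_measurable : set (set ((nat -> R) * (nat -> R))) :=
  <<s [set C | exists (n : nat) (B : set R), measurable B /\
         (C = [set p | B (p.1 n)] \/ C = [set p | B (p.2 n)])] >>.

Definition measurable_policy (A : policy) :=
  forall (past : seq 'I_K) (a : 'I_K),
    cylinder_measurable
      [set p | A (zip past (mkseq p.2 (size past))) p.1 = a].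

Record bandit_algorithm := BanditAlgorithm {
  bandit_policy :> policy ;
  bandit_policy_measurable : measurable_policy bandit_policy }.

(* [X t a] is the reward that arm [a] yields if it is pulled in round [t];
   only the entry of the arm actually pulled is revealed to the algorithm. *)
Fixpoint history (A : policy) (X : nat -> 'I_K -> R) (xi : nat -> R) (t : nat) :
    seq ('I_K * R) :=
  if t is t'.+1 then
    let h := history A X xi t' in
    let a := A h xi in rcons h (a, X t' a)
  else [::].

Definition arms (A : policy) (X : nat -> 'I_K -> R) (xi : nat -> R) (t : nat) :
    seq 'I_K :=
  unzip1 (history A X xi t).

End Algorithms.
Arguments policy : clear implicits.
Arguments bandit_algorithm : clear implicits.

(** * Stochastic environment *)

Section Environment.
Context {R : realType}.

Definition mutually_independent {d} {Om : measurableType d}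
    (P : probability Om R) {I : eqType} (Z : I -> {RV P >-> R}) :=
  forall (s : seq I) (B : I -> set R), uniq s ->
    (forall i, i \in s -> measurable (B i)) ->
    P (\bigcap_(i in [set` s]) (Z i @^-1` B i)) =
    (\prod_(i <- s) P (Z i @^-1` B i))%E.

Context {K : nat}.
Implicit Type D : 'I_K -> probability R R.

Definition supported01 D := forall a, D a `[0, 1]%classic = 1%E.

(* Executions of a bandit algorithm, indexed by [E], that share the internal
   randomness [xi], execution [e] having the reward table [X e]. *)
Definition bandit_model D {d} {Om : measurableType d} (P : probability Om R)
    (E : eqType) (xi : nat -> {RV P >-> R})
    (X : E -> nat -> 'I_K -> {RV P >-> R}) : Prop :=
  [/\ forall n (B : set R), measurable B ->
        distribution P (xi n) B = uniform_prob (@ltr01 R) B,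
      forall e t a (B : set R), measurable B ->
        distribution P (X e t a) B = D a B
    & mutually_independent
        (fun i : nat + E * nat * 'I_K =>
           match i with inl n => xi n | inr (e, t, a) => X e t a end)].

Definition mean D (a : 'I_K) : R := \int[D a]_x x.

(* For distributions on [0, 1] the means are nonnegative, so the starting
   value 0 does not affect the maximum over a nonempty set of arms. *)
Definition best_mean D : R := \big[Num.max/0]_(a < K) mean D a.

Definition gap D (j : 'I_K) : R := best_mean D - mean D j.

Definition replicable (T : nat) (rho : R) (A : bandit_algorithm R K) : Prop :=
  forall D, supported01 D ->
  forall (d : measure_display) (Om : measurableType d) (P : probability Om R)
    (xi : nat -> {RV P >-> R}) (X : bool -> nat -> 'I_K -> {RV P >-> R}),
  bandit_model D xi X ->
  ((1 - rho)%:E <=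
   P [set w | arms A (fun t a => X false t a w) (fun n => xi n w) T =
              arms A (fun t a => X true t a w) (fun n => xi n w) T])%E.

Definition expected_regret D (T : nat) (A : bandit_algorithm R K)
    {d} {Om : measurableType d} (P : probability Om R)
    (xi : nat -> {RV P >-> R}) (X : nat -> 'I_K -> {RV P >-> R}) : \bar R :=
  ((T%:R * best_mean D)%:E -
   'E_P[(fun w => \sum_(a <- arms A (fun t a => X t a w) (fun n => xi n w) T)
                     mean D a)%R])%E.

Definition regret_at_most D (T : nat) (A : bandit_algorithm R K) (b : R) : Prop :=
  forall (d : measure_display) (Om : measurableType d) (P : probability Om R)
    (xi : nat -> {RV P >-> R}) (X : nat -> 'I_K -> {RV P >-> R}),
  bandit_model D xi (fun _ : unit => X) ->
  (expected_regret D T A xi X <= b%:E)%E.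

End Environment.

(** * Running time

    A real random access machine, given as a small structured language. There
    are two unbounded memories, one of natural numbers (for arm numbers,
    counters and addresses) and one of real numbers. Every arithmetic
    operation, comparison, random draw or pull costs 1. Real numbers cannot be
    rounded or converted to naturals, and the only real constants are
    rational, so a program contains a finite amount of information. *)

(* [Dir n] is cell [n]; [Ind n] is the cell whose address is stored in cell
   [n] of the memory of naturals. *)
Inductive address := Dir of nat | Ind of nat.

Inductive nat_op := NAdd | NSub | NMul.
Inductive real_op := RAdd | RSub | RMul | RDiv.

(* The destination is the first address, except in [Pull a x]: pull the arm
   whose number is in the natural cell [a], store the reward in the real
   cell [x]. *)
Inductive instr :=
| NConst of address & nat
| NOp of nat_op & address & address & address
| RConst of address & rat
| ROp of real_op & address & address & address
| ROfNat of address & address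
| Draw of address
| Pull of address & address.

Inductive test := NLe of address & address | RLe of address & address.

Inductive program :=
| Skip
| Do of instr
| Seq of program & program
| If of test & program & program
| While of test & program.

Section Machine.
Context {R : realType} {K : nat}.

Record state := State {
  nmem : nat -> nat ;
  rmem : nat -> R ;
  drawn : nat ;
  pulled : seq 'I_K }.

Definition loc (s : state) (x : address) : nat :=
  match x with Dir n => n | Ind n => nmem s n end.
Definition nval (s : state) (x : address) : nat := nmem s (loc s x).
Definition rval (s : state) (x : address) : R := rmem s (loc s x).

Definition nset (s : state) (x : address) (v : nat) : state :=
  State [eta nmem s with loc s x |-> v] (rmem s) (drawn s) (pulled s).
Definition rset (s : state) (x : address) (v : R) : state :=
  State (nmem s) [eta rmem s with loc s x |-> v] (drawn s) (pulled s).

Definition eval_nop (o : nat_op) : nat -> nat -> nat :=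
  match o with
  | NAdd => fun m n => (m + n)%N
  | NSub => fun m n => (m - n)%N
  | NMul => fun m n => (m * n)%N
  end.

Definition eval_rop (o : real_op) : R -> R -> R :=
  match o with
  | RAdd => fun x y => x + y
  | RSub => fun x y => x - y
  | RMul => fun x y => x * y
  | RDiv => fun x y => x / y
  end.

Definition eval_test (b : test) (s : state) : bool :=
  match b with
  | NLe x y => (nval s x <= nval s y)%N
  | RLe x y => rval s x <= rval s y
  end.

Variables (X : nat -> 'I_K -> R) (xi : nat -> R).

(* The machine is stuck if it pulls an arm whose number is not below [K]. *)
Definition run_instr (i : instr) (s : state) : option state :=
  match i with
  | NConst x n => Some (nset s x n)
  | NOp o x y z => Some (nset s x (eval_nop o (nval s y) (nval s z)))
  | RConst x q => Some (rset s x (ratr q))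
  | ROp o x y z => Some (rset s x (eval_rop o (rval s y) (rval s z)))
  | ROfNat x y => Some (rset s x (nval s y)%:R)
  | Draw x =>
      let s' := rset s x (xi (drawn s)) in
      Some (State (nmem s') (rmem s') (drawn s).+1 (pulled s'))
  | Pull y x =>
      if insub (nval s y) is Some a then
        let s' := rset s x (X (size (pulled s)) a) in
        Some (State (nmem s') (rmem s') (drawn s') (rcons (pulled s) a))
      else None
  end.

(* [exec c s s' n]: started in [s], the program [c] halts in [s'] after [n]
   elementary operations. *)
Inductive exec : program -> state -> state -> nat -> Prop :=
| ExecSkip s : exec Skip s s 0
| ExecDo i s s' : run_instr i s = Some s' -> exec (Do i) s s' 1
| ExecSeq c1 c2 s1 s2 s3 n1 n2 :
    exec c1 s1 s2 n1 -> exec c2 s2 s3 n2 -> exec (Seq c1 c2) s1 s3 (n1 + n2)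
| ExecIf b c1 c2 s s' n :
    exec (if eval_test b s then c1 else c2) s s' n ->
    exec (If b c1 c2) s s' n.+1
| ExecWhileStop b c s : ~~ eval_test b s -> exec (While b c) s s 1
| ExecWhileLoop b c s1 s2 s3 n1 n2 :
    eval_test b s1 -> exec c s1 s2 n1 -> exec (While b c) s2 s3 n2 ->
    exec (While b c) s1 s3 (n1 + n2).+1.

End Machine.
Arguments state : clear implicits.

Definition input_state (R : realType) (K T : nat) (rho : R) : state R K :=
  State [eta (fun=> 0%N) with 0%N |-> T, 1%N |-> K]
        [eta (fun=> 0) with 0%N |-> rho] 0 [::].

(* On input [T], [K], [rho], whatever the rewards and the internal draws, the
   program pulls the arms that [A] prescribes for the horizon [T] and halts
   within [b] elementary operations. *)
Definition implements_within (R : realType) (K T : nat) (rho : R)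
    (c : program) (A : bandit_algorithm R K) (b : R) : Prop :=
  forall (X : nat -> 'I_K -> R) (xi : nat -> R),
    (forall t a, 0 <= X t a <= 1) -> (forall n, 0 <= xi n <= 1) ->
    exists (s : state R K) (n : nat),
      [/\ exec X xi c (input_state K T rho) s n,
          pulled s = arms A X xi T & n%:R <= b].

(* Main.v *)
Require Import Defs.
From mathcomp Require Import all_boot all_order all_algebra.
From mathcomp Require Import all_classical all_reals all_analysis.
From mathcomp Require Import finmap measurable_realfun simple_functions.
From mathcomp Require Import ring lra zify.

(** The algorithm eliminates arms in batches. In batch [i] every active arm is
    pulled [N * 4 ^ i] times in a row, where [N] is of order
    [log (K * T) * (K / rho) ^ 2], and an arm is dropped when its sum of fresh
    rewards is more than [N * 2 ^ i * (1 + u)] below the largest one; the single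
    internal draw [u] is shared by all batches.

    By a union bound over all start times of the blocks of pulls, with
    probability at least [1 - min (rho / 4, 1 / T)] every block of pulls that
    fits in the horizon estimates its mean up to a fraction of order [rho / K]
    of the threshold. Since the start times are quantified over, it does not
    matter that the actual ones depend on past rewards. On this event the best
    arm is never dropped, and an arm with gap [g] is dropped as soon as [2 ^ i]
    exceeds [6 / g], so it is pulled at most [48 * N / g ^ 2] times.

    If moreover no threshold is within the estimation error of a gap, the
    decisions of the algorithm depend only on [u] and on the means, so two
    executions agree. For each arm the threshold is close to the gap in at most
    two batches, and there [u] has to avoid an interval of length of order
    [rho / K]; this has probability at least [1 - rho / 2] for all arms
    together. *)

Set Implicit Arguments.
Unset Strict Implicit.
Unset Printing Implicit Defensive.
Import Order.TTheory GRing.Theory Num.Theory numFieldNormedType.Exports.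
Import HBNNSimple.
Local Open Scope classical_set_scope.
Local Open Scope ring_scope.

(** * Concentration of sums of independent rewards *)

(** The two factors of [N] have separate origins. In batch [i] the threshold is of order [N * 2 ^ i]
    and sums deviate by at most [W * 2 ^ i]. The draw spreads the threshold over an interval of
    relative length one, and each arm forbids intervals of length of order [W / N]. For all arms
    together to forbid at most [rho / 2], the ratio [N / W] must be of order [K / rho], while
    Hoeffding's inequality asks for [W ^ 2 / N] of order [log (K * T)]. Since [4 ^ i] is the square
    of [2 ^ i], both requirements are the same in every batch.

    A batch uses its own rewards only, so its sums are sums over windows in one column of the reward
    table, and at most [K * T ^ 2] windows matter. If [N > T] no window fits in the horizon, and
    nothing has to be estimated.

    The machine neither rounds nor takes logarithms, so [1 / rho] and [log (K * T)] are replaced by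
    integers that counting loops produce. *)

Section ComparisonSets.
Context {R : realType} {d} {T : measurableType d}.
Implicit Types f g : T -> R.

Lemma measurable_set_ler f g :
  measurable_fun setT f -> measurable_fun setT g ->
  measurable [set x | f x <= g x].
Proof.
by move=> mf mg; rewrite -[X in measurable X]setTI; exact: measurable_fun_le.
Qed.

Lemma measurable_set_ltr f g :
  measurable_fun setT f -> measurable_fun setT g ->
  measurable [set x | f x < g x].
Proof.
move=> mf mg; rewrite (_ : [set x | _] = ~` [set x | g x <= f x]).
  exact/measurableC/measurable_set_ler.
by apply/seteqP; split => x /=; rewrite ltNge => /negP.
Qed.

Lemma measurable_fun_bigmax {I : Type} (r : seq I) (f : I -> T -> R) :
  (forall i, measurable_fun setT (f i)) ->
  measurable_fun setT (fun x => \big[Num.max/0]_(i <- r) f i x).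
Proof.
move=> mf; elim: r => [|i r IH].
  by rewrite (_ : (fun x => _) = cst 0)//; apply/funext => x; rewrite big_nil.
rewrite (_ : (fun x => _) = (fun x => Num.max (f i x) (\big[Num.max/0]_(j <- r) f j x))).
  exact: measurable_maxr.
by apply/funext => x; rewrite big_cons.
Qed.

End ComparisonSets.

(** * Expectations of products of functions of independent variables *)

Section Independence.
Context {R : realType} {d} {Om : measurableType d} (P : probability Om R).

(** Both sides are additive in [f] and continuous along increasing sequences, so the case of
    indicators suffices; [f] is reached by simple functions. *)
Lemma ge0_integral_mul_indep (Z : {RV P >-> R}) (W : Om -> R) (f : R -> R) :
  measurable_fun setT W -> (forall w, 0 <= W w) ->
  (\int[P]_w (W w)%:E)%E \is a fin_num ->
  measurable_fun setT f -> (forall x, 0 <= f x) ->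
  (forall B, measurable B ->
    \int[P]_w (\1_(Z @^-1` B) w * W w)%:E =
    P (Z @^-1` B) * \int[P]_w (W w)%:E)%E ->
  (\int[P]_w (f (Z w) * W w)%:E =
   \int[P]_w (f (Z w))%:E * \int[P]_w (W w)%:E)%E.
Proof.
move=> mW W0 finW mf f0 ind.
have mEf : measurable_fun [set: R] (fun x : R => (f x)%:E).
  exact/measurable_EFinP.
pose g n := nnsfun_approx measurableT mEf n.
have mgR n : measurable_fun [set: R] (g n : R -> R) by [].
have mg n : measurable_fun [set: Om] (fun w => (g n : R -> R) (Z w)).
  exact: (measurableT_comp (mgR n)).
have gcvg x : (g n x)%:E @[n --> \oo] --> (f x)%:E.
  by apply: (cvg_nnsfun_approx measurableT mEf) => //= y _; rewrite lee_fin.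
have gnd x : {homo (fun n => g n x) : n m / (n <= m)%N >-> n <= m}.
  by move=> n m nm; apply/lefP/nd_nnsfun_approx.
have gge0 n x : 0 <= g n x by [].
have EW0 : (0 <= \int[P]_w (W w)%:E)%E.
  by apply: integral_ge0 => w _; rewrite lee_fin.
have cvgl : (\int[P]_w (g n (Z w) * W w)%:E @[n --> \oo] -->
             \int[P]_w (f (Z w) * W w)%:E)%E.
  rewrite [X in _ --> X](_ : _ = \int[P]_w
     (fun w => limn (fun n => (g n (Z w) * W w)%:E)) w)%E.
    apply: cvg_monotone_convergence => //.
    - by move=> n; apply/measurable_EFinP; exact: measurable_funM.
    - by move=> n w _; rewrite lee_fin mulr_ge0.
    - by move=> w _ n m nm; rewrite lee_fin ler_wpM2r// gnd.
  apply: eq_integral => w _; apply/esym/cvg_lim => //.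
  under eq_fun do rewrite EFinM; rewrite EFinM.
  by apply: cvgeZr => //; exact: gcvg.
have cvgr : (\int[P]_w (g n (Z w))%:E @[n --> \oo] -->
             \int[P]_w (f (Z w))%:E)%E.
  rewrite [X in _ --> X](_ : _ = \int[P]_w
     (fun w => limn (fun n => (g n (Z w))%:E)) w)%E.
    apply: cvg_monotone_convergence => //.
    - by move=> n; exact/measurable_EFinP.
    - by move=> n w _; rewrite lee_fin.
    - by move=> w _ n m nm; rewrite lee_fin gnd.
  by apply: eq_integral => w _; apply/esym/cvg_lim => //; exact: gcvg.
have eqg n : (\int[P]_w (g n (Z w) * W w)%:E =
              \int[P]_w (g n (Z w))%:E * \int[P]_w (W w)%:E)%E.
  have mpre y : measurable (Z @^-1` (g n @^-1` [set y])).
    by rewrite -[X in measurable X]setTI; apply: measurable_funPT.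
  (* [|y|] equals [y] on the range of [g n], and it makes every term nonnegative without knowing
     that [y] is in the range. *)
  have gE w : g n (Z w) = \sum_(y <- fset_set (range (g n)))
                   `|y| * \1_(Z @^-1` (g n @^-1` [set y])) w.
    rewrite [LHS]fimfunE fsbig_finite//=; apply: eq_bigr => y _.
    rewrite !indicE; have [/set_mem /= <-|yin] := boolP (Z w \in _).
      by rewrite ger0_norm// mem_set.
    rewrite memNset ?mulr0// => /= yE; move: yin; rewrite notin_setE /=.
    by rewrite yE.
  transitivity (\sum_(y <- fset_set (range (g n)))
     (`|y|%:E * (P (Z @^-1` (g n @^-1` [set y])) * \int[P]_w (W w)%:E)))%E.
    under eq_integral do rewrite gE mulr_suml -sumEFin.
    rewrite ge0_integral_sum//=.
    - apply: eq_bigr => y _; rewrite -ind//.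
      under eq_integral do rewrite -mulrA EFinM.
      rewrite ge0_integralZl//.
      + by apply/measurable_EFinP; apply: measurable_funM.
      + by move=> w _; rewrite lee_fin mulr_ge0.
    - move=> y; apply/measurable_EFinP; apply: measurable_funM => //.
      exact: measurable_funM.
    - by move=> y w _; rewrite lee_fin !mulr_ge0.
  under [in RHS]eq_integral do rewrite gE -sumEFin.
  rewrite ge0_integral_sum//=.
  - rewrite ge0_sume_distrl; last first.
      by move=> y _; apply: integral_ge0 => w _; rewrite lee_fin mulr_ge0.
    apply: eq_bigr => y ys; rewrite muleA; congr (_ * _)%E.
    under [RHS]eq_integral do rewrite EFinM.
    rewrite ge0_integralZl//.
    + by rewrite integral_indic// setIT.
    + exact/measurable_EFinP.
  - by move=> y; apply/measurable_EFinP; apply: measurable_funM.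
have cvgl' : (\int[P]_w (g n (Z w) * W w)%:E @[n --> \oo] -->
    \int[P]_w (f (Z w))%:E * \int[P]_w (W w)%:E)%E.
  by under eq_fun do rewrite eqg; exact: cvgeZr.
by rewrite -(cvg_lim _ cvgl)// -(cvg_lim _ cvgl').
Qed.


(** The events over [l2] are there for the induction on [l1]: testing the head variable against a
    set [B0] turns its factor into one more event, and the induction hypothesis applies to
    [i :: l2]. *)
Lemma integral_prod_indep (I : eqType) (Z : I -> {RV P >-> R})
    (f : I -> R -> R) (l1 l2 : seq I) (B : I -> set R) :
  mutually_independent Z ->
  (forall i, measurable_fun setT (f i)) -> (forall i x, 0 <= f i x) ->
  (forall i, i \in l1 -> (\int[P]_w (f i (Z i w))%:E)%E \is a fin_num) ->
  uniq (l1 ++ l2) -> (forall i, i \in l2 -> measurable (B i)) ->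
  (\int[P]_w (\prod_(i <- l1) f i (Z i w) *
              \1_(\bigcap_(i in [set` l2]) (Z i @^-1` B i)) w)%:E =
   \prod_(i <- l1) \int[P]_w (f i (Z i w))%:E *
   P (\bigcap_(i in [set` l2]) (Z i @^-1` B i)))%E.
Proof.
move=> indZ mf f0; pose C (l : seq I) (B : I -> set R) := \bigcap_(i in [set` l]) (Z i @^-1` B i).
have C0 B' : C [::] B' = setT by apply/seteqP; split => // w _ i.
have Ccons i l B' : C (i :: l) B' = (Z i @^-1` B' i) `&` C l B'.
  apply/seteqP; split => [w Cw|w [Ciw Cw] j /=].
    split; first by apply: Cw; rewrite /= inE eqxx.
    by move=> j /= jl; apply: Cw; rewrite /= inE jl orbT.
  by rewrite inE => /orP[/eqP ->//|jl]; exact: Cw.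
have mC l B' : (forall i, i \in l -> measurable (B' i)) -> measurable (C l B').
  elim: l => [|i l IHl] mB; first by rewrite C0.
  rewrite Ccons; apply: measurableI.
    rewrite -[X in measurable X]setTI; apply: measurable_funPT => //.
    by apply: mB; rewrite inE eqxx.
  by apply: IHl => j jl; apply: mB; rewrite inE jl orbT.
have mprod l : measurable_fun [set: Om] (fun w => \prod_(i <- l) f i (Z i w)).
  apply: measurable_prod => i _.
  exact: (measurableT_comp (mf i) (@measurable_funPT _ _ _ _ (Z i))).
elim: l1 l2 B => [|i l IH0] l2 B /=.
  move=> _ _ mB; under eq_integral do rewrite big_nil mul1r.
  by rewrite big_nil mul1e integral_indic ?setIT//; exact: mC.
move=> finf /andP[] il2 ul mB.
have finf' j : j \in l -> (\int[P]_w (f j (Z j w))%:E)%E \is a fin_num.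
  by move=> jl; apply: finf; rewrite inE jl orbT.
have IH := fun l2 B => IH0 l2 B finf'.
have finW : (\int[P]_w (\prod_(i <- l) f i (Z i w) * \1_(C l2 B) w)%:E)%E
    \is a fin_num.
  rewrite IH//; apply: fin_numM; last by rewrite fin_num_measure//; exact: mC.
  rewrite big_seq; elim/big_rec: _ => // j x jl xf.
  by apply: fin_numM => //; exact: finf'.
under eq_integral do rewrite big_cons -mulrA.
transitivity (\int[P]_w (f i (Z i w))%:E *
    \int[P]_w (\prod_(i <- l) f i (Z i w) * \1_(C l2 B) w)%:E)%E; last first.
  by rewrite IH// big_cons muleA.
apply: (@ge0_integral_mul_indep (Z i) (fun w => \prod_(i <- l) f i (Z i w) *
   \1_(C l2 B) w) (f i)) => //.
- by apply: measurable_funM => //; exact/measurable_indicP/mC.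
- by move=> w; rewrite mulr_ge0// prodr_ge0.
move=> B0 mB0; pose B' j := if j == i then B0 else B j.
have il : i \notin l2 by apply: contra il2 => il2; rewrite mem_cat il2 orbT.
have CE : C l2 B' = C l2 B.
  rewrite /C; apply: eq_bigcapr => j /= jl2; rewrite /B'.
  by case: eqP => // ji; rewrite -ji jl2 in il.
have mB' j : j \in i :: l2 -> measurable (B' j).
  by rewrite inE /B'; case: eqP => //= _; exact: mB.
have CiE : C (i :: l2) B' = (Z i @^-1` B0) `&` C l2 B.
  by rewrite Ccons CE {1}/B' eqxx.
under eq_integral => w _.
  rewrite mulrCA; have -> : \1_(Z i @^-1` B0) w * \1_(C l2 B) w =
    \1_(C (i :: l2) B') w :> R by rewrite CiE indicI.
  over.
have ul' : uniq (l ++ l2).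
  by move: ul; rewrite !cat_uniq.
have PE : P (C (i :: l2) B') = (P (Z i @^-1` B0) * P (C l2 B))%E.
  rewrite -CE /C !indZ ?big_cons//.
  - by rewrite {1}/B' eqxx.
  - by move: ul; rewrite cat_uniq => /and3P[].
  - by move=> j jl; apply: mB'; rewrite inE jl orbT.
  - by rewrite /= il; move: ul; rewrite cat_uniq => /and3P[].
rewrite [in RHS]IH// [LHS]IH//; first by rewrite -/(C (i :: l2) B') PE muleCA.
by move: il2 ul; rewrite mem_cat negb_or !cat_uniq /= => /andP[il1 _] /and3P[-> h ->];
  rewrite (negbTE il1) (negbTE h) il.
Qed.

End Independence.

(** * Hoeffding's inequality for variables in [0, 1] *)

Section MomentGeneratingFunction.
Context {R : realType}.

(** [expR x] is the inverse of [expR (- x) >= 1 - x], and [(1 + x + 2 x^2) (1 - x) = 1 + x^2 (1 - 2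
    x) >= 1]. *)
Lemma expR_le_quadratic (x : R) : x <= 1 / 2 -> expR x <= 1 + x + 2 * x ^+ 2.
Proof.
move=> x2; rewrite -[x in expR x]opprK expRN.
have h : 0 < 1 - x by lra.
rewrite -div1r ler_pdivrMr ?expR_gt0//.
apply: (@le_trans _ _ ((1 + x + 2 * x ^+ 2) * (1 - x))).
  suff : 0 <= x ^+ 2 * (1 - 2 * x) by nra.
  by rewrite mulr_ge0 ?sqr_ge0//; lra.
by rewrite ler_wpM2l ?expR_ge1Dx//; nra.
Qed.

Variables (D : probability R R).
Hypothesis D01 : D `[0, 1]%classic = 1%E.
Let A : set R := `[0, 1]%classic.

Let mA : measurable A. Proof. exact: measurable_itv. Qed.

Let DN : D (~` A) = 0%E.
Proof. by rewrite probability_setC// D01 subee. Qed.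

Let restr (f : R -> R) : measurable_fun setT f -> (forall x, 0 <= f x) ->
  (\int[D]_x (f x)%:E = \int[D]_(x in A) (f x)%:E)%E.
Proof.
move=> mf f0; rewrite (@ge0_negligible_integral _ _ _ D setT (~` A))//.
- by rewrite setTD setCK.
- exact: measurableC.
- exact/measurable_EFinP.
- by move=> x _; rewrite lee_fin.
Qed.

Lemma integrable_supported01 : D.-integrable setT (fun x : R => x%:E).
Proof.
apply/integrableP; split; first exact/measurable_EFinP.
rewrite [ltLHS](_ : _ = \int[D]_x `|x|%:E)%E //.
rewrite restr//; apply: (@le_lt_trans _ _ (\int[D]_(x in A) 1))%E.
  apply: ge0_le_integral => //.
  - by apply/measurable_EFinP; exact: normr_measurable.
  - move=> x; rewrite /A /= in_itv/= lee_fin => /andP[x0 x1].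
    by rewrite ger0_norm.
by rewrite integral_cst// mul1e (le_lt_trans (probability_le1 D mA))// ltry.
Qed.

Let mu := \int[D]_x x.

Lemma integral_supported01 : (\int[D]_(x in A) x%:E = mu%:E)%E.
Proof.
rewrite /mu /Rintegral fineK; last first.
  exact: integrable_fin_num integrable_supported01.
rewrite (@negligible_integral _ _ _ D setT (~` A))//.
- by rewrite setTD setCK.
- exact: measurableC.
- exact: integrable_supported01.
Qed.

Lemma mean_supported01 : 0 <= mu <= 1.
Proof.
rewrite -!lee_fin -integral_supported01; apply/andP; split.
  by apply: integral_ge0 => x; rewrite /A /= in_itv/= lee_fin => /andP[].
apply: (@le_trans _ _ (\int[D]_(x in A) 1))%E.
  apply: ge0_le_integral => //.
  - by move=> x; rewrite /A /= in_itv/= lee_fin => /andP[].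
  - by move=> x; rewrite /A /= in_itv/= lee_fin => /andP[].
by rewrite integral_cst// mul1e probability_le1.
Qed.

(** The quadratic bound applies because [|x - mu| <= 1] on the support. Its linear term has mean
    zero and its quadratic term is at most [2 * s ^+ 2]. *)
Lemma mgf_supported01 (s : R) : `|s| <= 1 / 2 ->
  (\int[D]_x (expR (s * (x - mu)))%:E <= (expR (2 * s ^+ 2))%:E)%E.
Proof.
move=> s2; have /andP[mu0 mu1] := mean_supported01.
have mexp : measurable_fun [set: R] (fun x => expR (s * (x - mu))).
  by apply: measurableT_comp => //; apply: measurable_funM => //; exact: measurable_funB.
rewrite restr//.
have s2' : s ^+ 2 <= 1 / 4.
  have := normr_ge0 s; rewrite -(@real_normK _ s) ?num_real//.
  by move: s2; set y := `|s| => y2 y0; nra.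
pose c := 1 + 2 * s ^+ 2 - s * mu.
apply: (@le_trans _ _ (\int[D]_(x in A) (c%:E + s%:E * x%:E)))%E.
  apply: ge0_le_integral => //.
  - by apply/measurable_EFinP; exact: measurable_funTS.
  - apply/measurable_EFinP; apply: measurable_funD => //.
  - move=> x; rewrite /A /= in_itv/= => /andP[x0 x1].
    rewrite -EFinM -EFinD lee_fin.
    have h1 : `|x - mu| <= 1 by rewrite ler_norml; lra.
    have h2 : s * (x - mu) <= 1 / 2.
      rewrite (le_trans (ler_norm _))// normrM.
      by rewrite -[1 / 2]mulr1 ler_pM.
    rewrite (le_trans (expR_le_quadratic h2))// exprMn /c.
    have h3 : (x - mu) ^+ 2 <= 1.
      by rewrite -(@real_normK _ (x - mu)) ?num_real// expr_le1.
    have h4 : s ^+ 2 * (x - mu) ^+ 2 <= s ^+ 2 by rewrite ler_piMr ?sqr_ge0.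
    lra.
have iA : D.-integrable A (fun x : R => x%:E).
  exact: integrableS integrable_supported01.
rewrite integralD//; last 2 first.
- exact: finite_measure_integrable_cst.
- exact: integrableZl.
have DA : D A = 1%E by [].
rewrite integral_cst// [X in (_ * X)%E]DA mule1 integralZl// integral_supported01.
rewrite -EFinM -EFinD lee_fin /c.
by rewrite subrK expR_ge1Dx.
Qed.

End MomentGeneratingFunction.

Section Tail.
Context {R : realType} {d} {Om : measurableType d} (P : probability Om R).
Context (I : eqType) (Z : I -> {RV P >-> R}) (D : probability R R) (l : seq I).
Hypothesis indZ : mutually_independent Z.
Hypothesis D01 : D `[0, 1]%classic = 1%E.
Hypothesis ZD : forall i (B : set R), i \in l -> measurable B ->
  distribution P (Z i) B = D B.
Hypothesis ul : uniq l.

Let mu := \int[D]_x x.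

Let dev w := \sum_(i <- l) Z i w - (size l)%:R * mu.

Let mdev : measurable_fun [set: Om] dev.
Proof.
by apply: measurable_funB => //; apply: measurable_sum.
Qed.

Let devM s w : expR (s * dev w) = \prod_(i <- l) expR (s * (Z i w - mu)).
Proof.
rewrite -expR_sum -mulr_sumr /dev; congr (expR (s * _)).
by rewrite sumrB big_const_seq count_predT iter_addr addr0 mulr_natl.
Qed.

(** Chernoff's bound; the sign of [s] selects the upper or the lower tail. *)
Let tail_le (s c : R) : `|s| <= 1 / 2 ->
  (P [set w | (c <= s * dev w)%R] <=
   (expR (2 * (size l)%:R * s ^+ 2 - c))%:E)%E.
Proof.
move=> s2; set A := [set w | _].
have mexp : measurable_fun [set: R] (fun x => expR (s * (x - mu))).
  by apply: measurableT_comp => //; apply: measurable_funM => //; exact: measurable_funB.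
have msdev : measurable_fun [set: Om] (fun w => s * dev w).
  exact: measurable_funM.
have mA : measurable A.
  exact: measurable_set_ler.
have intZ i : i \in l -> (\int[P]_w (expR (s * (Z i w - mu)))%:E =
    \int[D]_x (expR (s * (x - mu)))%:E)%E.
  move=> il; rewrite -(@ge0_integral_distribution _ _ _ _ _ P (Z i)
    (fun x => (expR (s * (x - mu)))%:E))//.
  - by apply: eq_measure_integral => B mB _; first [exact: ZD | exact/esym/ZD].
  - exact/measurable_EFinP.
have mgfD := mgf_supported01 D01 s2; rewrite -/mu in mgfD.
have finD : (\int[D]_x (expR (s * (x - mu)))%:E)%E \is a fin_num.
  rewrite ge0_fin_numE; first exact: le_lt_trans mgfD (ltry _).
  by apply: integral_ge0 => x _; rewrite lee_fin expR_ge0.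
(* Markov's inequality: on [A] the integrand is at least 1. *)
apply: (@le_trans _ _ (\int[P]_w (expR (- c) * expR (s * dev w))%:E))%E.
  rewrite -[P A]mul1e -[X in (_ * P X)%E]setIT -integral_cst//; last first.
    exact: measurableI.
  rewrite setIT integral_mkcond; apply: ge0_le_integral => //.
  - by move=> w _; rewrite erestrict_ge0.
  - by apply/(measurable_restrictT _ mA).
  - by apply/measurable_EFinP; apply: measurable_funM => //; exact: measurableT_comp.
  - move=> w _; rewrite patchE; case: ifPn => wA.
      rewrite lee_fin -expRD -[leLHS]expR0 ler_expR addrC subr_ge0.
      exact: (set_mem wA).
    by rewrite lee_fin mulr_ge0// expR_ge0.
under eq_integral do rewrite EFinM.
rewrite ge0_integralZl//; last first.
  by apply/measurable_EFinP; exact: measurableT_comp.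
rewrite addrC expRD EFinM; apply: lee_wpmul2l; first by rewrite lee_fin expR_ge0.
under eq_integral do rewrite devM.
have := @integral_prod_indep _ _ _ P I Z (fun _ x => expR (s * (x - mu))) l [::]
  (fun=> setT) indZ (fun=> mexp).
rewrite cats0 => /(_ (fun _ x => expR_ge0 _)) E.
have -> : (\int[P]_w (\prod_(i <- l) expR (s * (Z i w - mu)))%:E =
    \prod_(i <- l) \int[P]_w (expR (s * (Z i w - mu)))%:E)%E.
  have C0 : \bigcap_(i in [set` ([::] : seq I)]) (Z i @^-1` setT) = setT.
    by apply/seteqP; split.
  move: E; rewrite C0 probability_setT mule1 => <- //.
  - by apply: eq_integral => w _; rewrite indicT mulr1.
  - by move=> i il; rewrite intZ.
have prod_const (a : R) : \prod_(i <- l) a = a ^+ size l.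
  by rewrite big_const_seq count_predT iter_mulr_1.
rewrite (eq_big_seq (fun=> (fine (\int[D]_x (expR (s * (x - mu)))%:E))%:E)).
  rewrite prodEFin lee_fin prod_const.
  have -> : expR (2 * (size l)%:R * s ^+ 2) = expR (2 * s ^+ 2) ^+ size l.
    by rewrite -expRM_natl; congr expR; ring.
  rewrite lerXn2r ?nnegrE ?expR_ge0//.
    by rewrite fine_ge0// integral_ge0// => x _; rewrite lee_fin expR_ge0.
  by rewrite -lee_fin fineK.
by move=> i il; rewrite intZ// fineK.
Qed.

(** The value [s = W / (4 n)] minimises [2 n s^2 - s W]; the upper bound on [W] is the condition
    [|s| <= 1 / 2]. *)
Lemma hoeffding_tail (W : R) : 0 <= W <= 2 * (size l)%:R ->
  (P [set w | (W < `|\sum_(i <- l) Z i w - (size l)%:R * mu|)%R] <=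
   (2 * expR (- (W ^+ 2 / (8 * (size l)%:R))))%:E)%E.
Proof.
move=> /andP[W0 W2].
have mset : measurable [set w | (W < `|dev w|)%R].
  by apply: measurable_set_ltr => //; exact: measurableT_comp.
(* Without variables the quotient by 0 is 0, and the bound reads 2. *)
have [n0|npos] := posnP (size l).
  apply: (le_trans (probability_le1 P mset)).
  by rewrite n0 mulr0 invr0 mulr0 oppr0 expR0 mulr1 lee_fin ler1n.
set n := (size l)%:R in W2 *.
have n0 : 0 < n by rewrite ltr0n.
pose s := W / (4 * n).
have s0 : 0 <= s by rewrite divr_ge0// mulr_ge0// ltW.
have s2 : `|s| <= 1 / 2.
  by rewrite ger0_norm// ler_pdivrMr ?mulr_gt0//; lra.
have e : 2 * n * s ^+ 2 - s * W = - (W ^+ 2 / (8 * n)).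
  by rewrite /s; field; rewrite gt_eqF.
have md c t : measurable [set w | c <= t * dev w].
  by apply: measurable_set_ler => //; exact: measurable_funM.
apply: (@le_trans _ _ (P ([set w | (s * W <= s * dev w)%R] `|`
                          [set w | (s * W <= (- s) * dev w)%R]))).
  apply: le_measure; [exact/mem_set|exact/mem_set/measurableU|].
  move=> w; rewrite /= -/n -/(dev w) ltr_normr => /orP[|] h; [left|right] => /=.
    by rewrite ler_wpM2l// ltW.
  by rewrite mulNr -mulrN ler_wpM2l// ltW.
apply: (le_trans (measureU2 _ (md _ _) (md _ _))).
rewrite mulrDl mul1r EFinD; apply: leeD; rewrite -e; first exact: tail_le.
by rewrite -(sqrrN s); apply: tail_le; rewrite normrN.
Qed.

End Tail.

(** * The elimination algorithm *)

Section DiscreteMeasurability.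
Context {d} {T : measurableType d}.

(** Used for maps into lists of arms and batch states, which carry no sigma-algebra; for countable
    [C] it is measurability with respect to the discrete one. *)
Definition measurable_fibers {C : Type} (f : T -> C) :=
  forall c, measurable [set x | f x = c].

Lemma measurable_fibers_cst {C : Type} (c : C) : measurable_fibers (fun=> c).
Proof.
move=> c'; have [->|cc'] := pselect (c = c').
  by rewrite (_ : [set _ | _] = setT)//; apply/seteqP; split.
by rewrite (_ : [set _ | _] = set0)//; apply/seteqP; split.
Qed.

Lemma measurable_fibers_bind {C : countType} {C' : Type} (f : T -> C)
    (g : C -> T -> C') :
  measurable_fibers f -> (forall c, measurable_fibers (g c)) ->
  measurable_fibers (fun x => g (f x) x).
Proof.
move=> mf mg c'; pose F n : set T :=
  if (pickle_inv n : option C) is Some c then [set x | f x = c] `&` [set x | g c x = c']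
  else set0.
rewrite (_ : [set x | _] = \bigcup_n F n).
  apply: bigcupT_measurable => n; rewrite /F; case: pickle_inv => // c.
  by apply: measurableI; [exact: mf|exact: mg].
apply/seteqP; split=> [x /= gx|x [n _]].
  by exists (choice.pickle (f x)) => //; rewrite /F pickleK_inv.
by rewrite /F; case: pickle_inv => // c [/= -> ->].
Qed.

Lemma measurable_fibers_filter {C : Type} (keep : C -> T -> bool) (s : seq C) :
  (forall c, measurable [set x | keep c x]) ->
  measurable_fibers (fun x => [seq c <- s | keep c x]).
Proof.
move=> mkeep; elim: s => [|c s IH]; first exact: measurable_fibers_cst.
have mNk : measurable [set x | ~~ keep c x].
  rewrite (_ : [set x | _] = ~` [set x | keep c x]); first exact: measurableC.
  by apply/seteqP; split => x /= /negP.
move=> s'; rewrite (_ : [set x | _] =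
    [set x | keep c x] `&` [set x | c :: [seq c <- s | keep c x] = s'] `|`
    [set x | ~~ keep c x] `&` [set x | [seq c <- s | keep c x] = s']).
  apply: measurableU; apply: measurableI => //.
  case: s' => [|c' s'].
    by rewrite (_ : [set x | _] = set0)//; apply/seteqP; split.
  have [->|cc'] := pselect (c = c').
    rewrite (_ : [set x | _] = [set x | [seq c <- s | keep c x] = s']) => //.
    by apply/seteqP; split => x /= => [[]|->].
  by rewrite (_ : [set x | _] = set0)//; apply/seteqP; split => // x [].
apply/seteqP; split=> x /=; first by case: ifP => kcx; [left|right].
by case=> -[kcx]; rewrite ?kcx ?(negbTE kcx).
Qed.

End DiscreteMeasurability.

Section Elimination.
Context {R : realType} {K : nat}.

Definition arm_sum (h : seq ('I_K * R)) (a : 'I_K) : R :=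
  \sum_(x <- h | x.1 == a) x.2.

(** The maximum may run over all arms: one that is not pulled in the batch has sum 0, and rewards
    are nonnegative. *)
Definition top_sum (h : seq ('I_K * R)) : R := \big[Num.max/0]_(a < K) arm_sum h a.

Definition survivors (th : R) (s : seq 'I_K) (h : seq ('I_K * R)) :=
  [seq a <- s | top_sum h - th <= arm_sum h a].

Variable N : nat.

Definition pulls (i : nat) : nat := N * 4 ^ i.

Definition threshold (i : nat) (u : R) : R := (N * 2 ^ i)%:R * (1 + u).

(* [(i, s, t0)]: batch [i] started in round [t0] with active arms [s]. *)
Fixpoint batch (h : seq ('I_K * R)) (u : R) (t : nat) : nat * seq 'I_K * nat :=
  if t is t'.+1 then
    let: (i, s, t0) := batch h u t' in
    if t == (t0 + pulls i * size s)%N then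
      (i.+1, survivors (threshold i u) s (drop t0 (take t h)), t)
    else (i, s, t0)
  else (0%N, enum 'I_K, 0%N).

(** Active arms are served in list order, each for [pulls N i] consecutive rounds, so a quotient
    gives the position of the current one. *)
Definition elimination_policy (a0 : 'I_K) : policy R K := fun h xi =>
  let: (i, s, t0) := batch h (xi 0%N) (size h) in
  nth a0 s ((size h - t0) %/ pulls i).

(** For given past arms the batch state is a countably valued function of the rewards and the draw,
    updated by comparing measurable functions; measurability follows round by round. *)
Lemma measurable_elimination_policy a0 :
  measurable_policy (elimination_policy a0).
Proof.
move=> past a.
pose G : set_system ((nat -> R) * (nat -> R)) :=
  [set C | exists (n : nat) (B : set R), measurable B /\
         (C = [set p | B (p.1 n)] \/ C = [set p | B (p.2 n)])].
pose T := g_sigma_algebraType G.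
pose h (p : T) := zip past (mkseq p.2 (size past)).
have m1 n : measurable_fun [set: T] (fun p : T => p.1 n).
  move=> _ B mB; rewrite setTI; apply: sub_sigma_algebra; exists n, B.
  by split => //; left.
have m2 n : measurable_fun [set: T] (fun p : T => p.2 n).
  move=> _ B mB; rewrite setTI; apply: sub_sigma_algebra; exists n, B.
  by split => //; right.
have hE p : h p = [seq (nth a0 past j, p.2 j) | j <- iota 0 (size past)].
  by rewrite /h -{1}(mkseq_nth a0 past) /mkseq zip_map.
have msum t0 t b : measurable_fun [set: T]
    (fun p : T => arm_sum (drop t0 (take t (h p))) b).
  rewrite (_ : (fun p => _) = (fun p : T =>
    \sum_(j <- drop t0 (take t (iota 0 (size past)))) 
       (if nth a0 past j == b then p.2 j else 0))).
    by apply: measurable_sum => j; case: (nth a0 past j == b).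
  by apply/funext => p; rewrite /arm_sum hE -map_take -map_drop big_map big_mkcond.
have mtop t0 t : measurable_fun [set: T]
    (fun p : T => top_sum (drop t0 (take t (h p)))).
  by apply: measurable_fun_bigmax => b; exact: msum.
have mth i : measurable_fun [set: T] (fun p : T => threshold i (p.1 0%N)).
  by apply: measurable_funM => //; exact: measurable_funD.
have mbatch t : measurable_fibers (fun p : T => batch (h p) (p.1 0%N) t).
  elim: t => [|t IH]; first exact: measurable_fibers_cst.
  apply: (@measurable_fibers_bind _ T _ _ _ (fun st p =>
    let: (i, s, t0) := st in
    if t.+1 == (t0 + pulls i * size s)%N then
      (i.+1, survivors (threshold i (p.1 0%N)) s (drop t0 (take t.+1 (h p))), t.+1)
    else (i, s, t0)) IH) => -[[i s] t0].
  case: (t.+1 == (t0 + pulls i * size s)%N); last exact: measurable_fibers_cst.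
  apply: (@measurable_fibers_bind _ T _ _ _ (fun s' _ => (i.+1, s', t.+1))).
    apply: measurable_fibers_filter => b; apply: measurable_set_ler => //.
    exact: measurable_funB.
  by move=> s'; exact: measurable_fibers_cst.
have szh p : size (h p) = size past by rewrite size_zip size_mkseq minnn.
have : measurable_fibers (fun p : T => elimination_policy a0 (h p) p.1).
  rewrite (_ : (fun p => _) = (fun p : T =>
    let: (i, s, t0) := batch (h p) (p.1 0%N) (size past) in
    nth a0 s ((size past - t0) %/ pulls i))); last first.
    by apply/funext => p; rewrite /elimination_policy szh.
  apply: (@measurable_fibers_bind _ T _ _ _ (fun st _ =>
    let: (i, s, t0) := st in nth a0 s ((size past - t0) %/ pulls i)) (mbatch _)).
  by move=> -[[i s] t0]; exact: measurable_fibers_cst.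
exact.
Qed.

Definition elimination (a0 : 'I_K) : bandit_algorithm R K :=
  BanditAlgorithm (measurable_elimination_policy a0).

End Elimination.

(** * The sequence of pulled arms as a random variable *)

Section ArmsEvents.
Context {R : realType} {K : nat} {d} {Om : measurableType d}.
Variables (X : nat -> 'I_K -> Om -> R) (xi : nat -> Om -> R).
Hypothesis mX : forall t a, measurable_fun setT (X t a).
Hypothesis mxi : forall n, measurable_fun setT (xi n).

Lemma measurable_cylinder_preimage (f g : nat -> Om -> R) S :
  (forall n, measurable_fun setT (f n)) -> (forall n, measurable_fun setT (g n)) ->
  cylinder_measurable S ->
  measurable [set w | S (fun n => f n w, fun n => g n w)].
Proof.
move=> mf mg; pose phi w := (fun n => f n w, fun n => g n w).
suff /(_ S) : (cylinder_measurable (R := R)) `<=`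
    [set S | measurable (phi @^-1` S)] by exact.
apply: smallest_sub.
  split=> /=.
  - by rewrite preimage_set0.
  - by move=> A mA; rewrite setTD preimage_setC; exact: measurableC.
  - by move=> F mF; rewrite preimage_bigcup; exact: bigcupT_measurable.
move=> _ [n [B [mB [->|->]]]] /=.
  by rewrite -[X in measurable X]setTI; exact: mf.
by rewrite -[X in measurable X]setTI; exact: mg.
Qed.

(** The arms and the reward table determine the history. Once the arms are fixed, the next choice
    has the form to which [measurable_policy] applies. *)
Lemma history_arms (A : policy R K) (Y : nat -> 'I_K -> R) (z : nat -> R) t
    (l : seq 'I_K) a0 : arms A Y z t = l ->
  history A Y z t = zip l (mkseq (fun j => Y j (nth a0 l j)) (size l)).
Proof.
rewrite /arms => <-; elim: t => [|t IH] //=.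
set h := history _ _ _ _ in IH *.
have sh : size h = t by rewrite /h; elim: (t) => //= n IHn; rewrite size_rcons IHn.
rewrite [unzip1 _]map_rcons /= size_rcons mkseqS zip_rcons ?size_mkseq//.
rewrite nth_rcons size_map ltnn eqxx sh; congr rcons.
rewrite [LHS]IH size_map sh; congr zip; apply/eq_in_map => j.
by rewrite mem_iota /= add0n nth_rcons size_map sh => ->.
Qed.

Lemma measurable_arms (A : bandit_algorithm R K) t :
  measurable_fibers
    (fun w => arms A (fun t a => X t a w) (fun n => xi n w) t).
Proof.
case: (posnP K) => [K0|K0].
  have nil (s : seq 'I_K) : s = [::].
    by case: s => [//|a s]; have := ltn_ord a; rewrite {2}K0.
  rewrite (_ : (fun w => _) = (fun=> [::])); first exact: measurable_fibers_cst.
  by apply/funext => w; exact: nil.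
pose a0 := Ordinal K0.
elim: t => [|t IH]; first exact: measurable_fibers_cst.
pose g (l : seq 'I_K) w := bandit_policy A (zip l (mkseq (fun j => X j (nth a0 l j) w) (size l)))
   (fun n => xi n w).
rewrite (_ : (fun w => _) = (fun w => (fun l w => rcons l (g l w))
    (arms A (fun t a => X t a w) (fun n => xi n w) t) w)).
  apply: (@measurable_fibers_bind _ _ _ _ _ (fun l w => rcons l (g l w)) IH) => l.
  apply: (@measurable_fibers_bind _ _ _ _ _ (fun a _ => rcons l a)).
    move=> a; have := bandit_policy_measurable A l a.
    by apply: measurable_cylinder_preimage.
  by move=> a; exact: measurable_fibers_cst.
apply/funext => w; rewrite /arms /= [unzip1 _]map_rcons /=; congr rcons.
by rewrite /g; congr (bandit_policy A _ _); exact: history_arms.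
Qed.

End ArmsEvents.

(** * Executions with accurate estimates *)

Section Blocks.
Context {R : realType} {K : nat} (X : nat -> 'I_K -> R).

(** The record of a batch that runs to its end; at any moment the record of the current batch is a
    prefix of it. *)
Fixpoint blocks (n : nat) (s : seq 'I_K) (t0 : nat) : seq ('I_K * R) :=
  if s is b :: s' then
    [seq (b, X t b) | t <- iota t0 n] ++ blocks n s' (t0 + n)
  else [::].

Lemma size_blocks n s t0 : size (blocks n s t0) = (n * size s)%N.
Proof.
elim: s t0 => [|b s IH] t0 /=; first by rewrite muln0.
by rewrite size_cat size_map size_iota IH mulnS.
Qed.

Lemma nth_blocks a0 n s t0 q (a := nth a0 s (q %/ n)) x0 :
  (q < n * size s)%N -> nth x0 (blocks n s t0) q = (a, X (t0 + q) a).
Proof.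
rewrite {}/a; elim: s t0 q => [|b s IH] t0 q /=; first by rewrite muln0.
move=> q_lt; rewrite nth_cat size_map size_iota; case: ltnP => qn.
  by rewrite (nth_map 0%N) ?size_iota// nth_iota// divn_small.
have n0 : (0 < n)%N by case: n q_lt {IH qn} => //; rewrite mul0n.
rewrite IH; last by rewrite ltn_subLR// -mulnS.
rewrite -addnA subnKC//.
have -> : (q %/ n = ((q - n) %/ n).+1)%N.
  by rewrite -{1}(subnK qn) divnDr ?dvdnn// divnn n0 addn1.
by [].
Qed.

Lemma arm_sum_cat (h1 h2 : seq ('I_K * R)) a :
  arm_sum (h1 ++ h2) a = arm_sum h1 a + arm_sum h2 a.
Proof. by rewrite /arm_sum big_cat. Qed.

Lemma arm_sum_blocks_notin n s t0 a :
  a \notin s -> arm_sum (blocks n s t0) a = 0.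
Proof.
elim: s t0 => [|b s IH] t0 /=; first by rewrite /arm_sum big_nil.
rewrite inE negb_or => /andP[ab /IH as0]; rewrite arm_sum_cat as0 addr0.
by rewrite /arm_sum big_map /= eq_sym (negbTE ab) big_pred0.
Qed.

Lemma arm_sum_blocks n s t0 a : uniq s -> a \in s ->
  arm_sum (blocks n s t0) a =
  \sum_(t <- iota (t0 + n * index a s) n) X t a.
Proof.
elim: s t0 => //= b s IH t0 /andP[bs us]; rewrite inE arm_sum_cat.
have [->|ab] /= := eqVneq a b.
  move=> _; rewrite muln0 addn0 arm_sum_blocks_notin// addr0.
  by rewrite /arm_sum big_map /= eqxx.
move=> /(IH (t0 + n)%N us) ->; rewrite mulnS addnA.
by rewrite /arm_sum big_map /= eq_sym (negbTE ab) big_pred0 ?add0r.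
Qed.

Lemma count_blocks n s t0 a : uniq s ->
  (count_mem a (unzip1 (blocks n s t0)) = n * (a \in s))%N.
Proof.
elim: s t0 => [|b s IH] t0 /=; first by rewrite muln0.
move=> /andP[bs us]; rewrite [unzip1 _]map_cat count_cat IH// inE -map_comp.
have -> : count_mem a [seq (fst \o (fun t => (b, X t b))) t | t <- iota t0 n] =
    (n * (b == a))%N.
  rewrite count_map -[in RHS](size_iota t0 n).
  by elim: (iota t0 n) => //= t l ->; rewrite mulSn.
rewrite [b == a]eq_sym; have [->|_] := eqVneq a b; last by rewrite muln0.
by rewrite (negbTE bs) muln0 addn0.
Qed.

End Blocks.

(** * Deterministic analysis of one execution *)

Section Trajectory.
Context {R : realType} {K : nat} (N : nat) (a0 : 'I_K).
Variables (X : nat -> 'I_K -> R) (xi : nat -> R).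
Hypothesis N0 : (0 < N)%N.

Let u := xi 0%N.
Let H t := history (elimination_policy N a0) X xi t.
Let S t := batch N (H t) u t.

Lemma pulls_gt0 i : (0 < pulls N i)%N.
Proof. by rewrite muln_gt0 N0 expn_gt0. Qed.

Lemma size_history t : size (H t) = t.
Proof. by rewrite /H; elim: t => //= t IH; rewrite size_rcons IH. Qed.

(** Holds because [batch] at time [t] reads [take t h] only. *)
Lemma batch_rcons (h : seq ('I_K * R)) x t : (t <= size h)%N ->
  batch N (rcons h x) u t = batch N h u t.
Proof.
elim: t => // t IH th /=; rewrite IH ?(ltnW th)//.
case: (batch _ _ _ _) => [[i s] t0].
by rewrite -cats1 takel_cat.
Qed.

Lemma batch_history_step t i s t0 : S t = (i, s, t0) ->
  S t.+1 = if t.+1 == (t0 + pulls N i * size s)%N then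
             (i.+1, survivors (threshold N i u) s (drop t0 (H t.+1)), t.+1)
           else (i, s, t0).
Proof.
move=> St; rewrite /S /=; rewrite batch_rcons ?size_history// -/(S t) St.
by rewrite take_oversize// size_rcons size_history.
Qed.

Lemma history_step t i s t0 (a := nth a0 s ((t - t0) %/ pulls N i)) :
  S t = (i, s, t0) -> H t.+1 = rcons (H t) (a, X t a).
Proof.
move=> St; rewrite /H /= -/(H t) /elimination_policy size_history -/u.
by rewrite -/(S t) St.
Qed.

(** A batch is replaced in the very round that completes it, hence the strict bound on [t]. The
    guards exclude an empty list of arms, whose batch of length 0 would never be closed. *)
Lemma batch_history_inv t i s t0 : S t = (i, s, t0) ->
  [/\ (t0 <= t)%N, uniq s, (s != [::] -> t < t0 + pulls N i * size s)%N &
      s != [::] -> drop t0 (H t) = take (t - t0) (blocks X (pulls N i) s t0)].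
Proof.
elim: t i s t0 => [|t IH] i s t0.
  case=> <- <- <-; split => //; first exact: enum_uniq.
    by case: (enum _) => //= a l _; rewrite add0n muln_gt0 pulls_gt0.
  by rewrite take0.
case St : (S t) => [[i' s'] t0']; have [t0t us tlt dH] := IH _ _ _ St.
rewrite (batch_history_step St); case: eqP => [tE|tN] [<- <- <-]; split => //.
- by rewrite filter_uniq.
- by rewrite -size_eq0 => s0; rewrite -addn1 leq_add2l muln_gt0 pulls_gt0 lt0n.
- by move=> _; rewrite subnn take0 drop_oversize ?size_history.
- exact: leqW.
- by move=> s0; rewrite ltn_neqAle tlt// andbT; apply/eqP.
- move=> s0; rewrite (history_step St) subSn// (take_nth (a0, 0)); last first.
    by rewrite size_blocks ltn_subLR// tlt.
  rewrite (@nth_blocks _ _ X a0); last by rewrite ltn_subLR// tlt.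
  by rewrite subnKC// drop_rcons ?size_history// dH.
Qed.

Lemma batch_end t i s t0 : S t = (i, s, t0) -> s != [::] ->
  t.+1 = (t0 + pulls N i * size s)%N ->
  drop t0 (H t.+1) = blocks X (pulls N i) s t0.
Proof.
move=> St s0 tE; have [t0t us tlt dH] := batch_history_inv St.
rewrite (history_step St) drop_rcons ?size_history// dH//.
have q_lt : (t - t0 < pulls N i * size s)%N by rewrite ltn_subLR// tlt.
rewrite -[RHS](@take_oversize _ (t - t0).+1).
  by rewrite (take_nth (a0, 0)) ?size_blocks// (@nth_blocks _ _ X a0)// subnKC.
by rewrite size_blocks -subSn// tE addKn.
Qed.

Lemma pulled_active t i s t0 : S t = (i, s, t0) -> s != [::] ->
  nth a0 s ((t - t0) %/ pulls N i) \in s.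
Proof.
move=> St s0; have [t0t us /(_ s0) tlt _] := batch_history_inv St.
by rewrite mem_nth// ltn_divLR ?pulls_gt0// mulnC ltn_subLR.
Qed.

Section GoodRewards.
Variables (mu : 'I_K -> R) (b : 'I_K) (W : R) (T : nat).
Hypothesis mu01 : forall a, 0 <= mu a <= 1.
Hypothesis mu_best : forall a, mu a <= mu b.
Hypothesis u01 : 0 <= u <= 1.
Hypothesis WN : 2 * W <= N%:R.

(** The tolerance grows like the square root of the number of pulls, and thus stays a fixed fraction
    of the threshold. *)
Definition good_windows := forall t0 i a, (t0 < T)%N -> (pulls N i <= T)%N ->
  `|\sum_(t <- iota t0 (pulls N i)) X t a - (pulls N i)%:R * mu a|
  <= W * 2 ^+ i.

Hypothesis good : good_windows.

Lemma arm_sum_good t i s t0 a : S t = (i, s, t0) -> a \in s -> (t < T)%N ->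
  t.+1 = (t0 + pulls N i * size s)%N ->
  `|arm_sum (drop t0 (H t.+1)) a - (pulls N i)%:R * mu a| <= W * 2 ^+ i.
Proof.
move=> St as_ tT tE; have s0 : s != [::] by case: (s) as_.
have [t0t us _ _] := batch_history_inv St.
rewrite (batch_end St)// arm_sum_blocks//.
have ia : (index a s < size s)%N by rewrite index_mem.
have n0 := pulls_gt0 i.
(* The batch ends within the horizon, so the window starts before [T] and its length is at most
   [T]. *)
apply: good; nia.
Qed.

Lemma top_sum_good t i s t0 : S t = (i, s, t0) -> b \in s -> (t < T)%N ->
  t.+1 = (t0 + pulls N i * size s)%N ->
  `|top_sum (drop t0 (H t.+1)) - (pulls N i)%:R * mu b| <= W * 2 ^+ i.
Proof.
move=> St bs tT tE; set n := (pulls N i)%:R.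
have n0 : 0 <= n by rewrite ler0n.
have gb := arm_sum_good St bs tT tE; have s0 : s != [::] by case: (s) bs.
have W0 : 0 <= W * 2 ^+ i by exact: le_trans gb.
have nmu a : 0 <= n * mu a <= n * mu b.
  have /andP[mu0 _] := mu01 a; rewrite mulr_ge0//=; exact: ler_wpM2l.
rewrite ler_distl; apply/andP; split.
  apply: (@le_trans _ _ (arm_sum (drop t0 (H t.+1)) b)).
    by move: gb; rewrite ler_distl => /andP[].
  by rewrite /top_sum; apply: le_bigmax.
rewrite /top_sum; apply/bigmax_leP; split => [|a _].
  by have := nmu b; lra.
have [as_|as_] := boolP (a \in s).
  have := arm_sum_good St as_ tT tE; rewrite ler_distl -/n.
  by have := nmu a; lra.
rewrite (batch_end St)// arm_sum_blocks_notin//.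
by have := nmu b; lra.
Qed.

(** The largest sum and the sum of [a] each err by at most [W * 2 ^+ i], so the decision is that of
    the true gap up to twice this error. *)
Lemma survivors_good t i s t0 a (n := (pulls N i)%:R) :
  S t = (i, s, t0) -> b \in s -> a \in s -> (t < T)%N ->
  t.+1 = (t0 + pulls N i * size s)%N ->
  if a \in survivors (threshold N i u) s (drop t0 (H t.+1)) then
    n * (mu b - mu a) <= threshold N i u + 2 * W * 2 ^+ i
  else threshold N i u - 2 * W * 2 ^+ i < n * (mu b - mu a).
Proof.
move=> St bs as_ tT tE; rewrite mem_filter as_ andbT.
have := top_sum_good St bs tT tE; have := arm_sum_good St as_ tT tE.
rewrite -/n !ler_distl; case: ifPn; rewrite -?ltNge; lra.
Qed.

(** Dropping the best arm, whose gap is 0, would take a threshold below [2 * W * 2 ^+ i], but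
    thresholds are at least [N * 2 ^+ i]. *)
Lemma best_active t i s t0 : (t <= T)%N -> S t = (i, s, t0) -> b \in s.
Proof.
elim: t i s t0 => [|t IH] i s t0 tT; first by case=> _ <- _; rewrite mem_enum.
case St : (S t) => [[i' s'] t0']; have bs' := IH _ _ _ (ltnW tT) St.
rewrite (batch_history_step St); case: eqP => [tE|tN] [_ <- _] //.
have := survivors_good St bs' bs' tT tE; case: ifP => // _.
rewrite subrr mulr0 subr_lt0 ltNge => /negP; case.
rewrite /threshold natrM natrX [in leRHS]mulrAC ler_wpM2r ?exprn_ge0//.
by rewrite (le_trans WN)// ler_peMr// lerDl; have /andP[] := u01.
Qed.

(** Surviving batch [i'] with gap [g] gives [N * 4 ^ i' * g <= 3 * N * 2 ^ i'], where the threshold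
    contributes at most 2 and the errors at most 1; passing to the next batch doubles 3 to 6. *)
Lemma active_gap t i s t0 a : (t <= T)%N -> S t = (i, s, t0) -> a \in s ->
  2 ^+ i * (mu b - mu a) <= 6.
Proof.
elim: t i s t0 => [|t IH] i s t0 tT.
  by case=> <- _ _ _; have := mu01 a; have := mu01 b; rewrite expr0; lra.
case St : (S t) => [[i' s'] t0']; have bs' := best_active (ltnW tT) St.
rewrite (batch_history_step St); case: eqP => [tE|tN] [<- <- _]; last first.
  exact: IH (ltnW tT) St.
move=> as_; have as' : a \in s' by move: as_; rewrite mem_filter => /andP[].
have := survivors_good St bs' as' tT tE; rewrite as_ /threshold /pulls.
rewrite !natrM !natrX (_ : 4 = 2 * 2) ?exprMn; last by rewrite -natrM.
have p0 : (0 : R) < N%:R * 2 ^+ i' by rewrite mulr_gt0 ?ltr0n ?exprn_gt0.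
move=> h; rewrite exprS -subr_ge0 -(pmulr_rge0 _ p0).
have {}h : N%:R * (2 ^+ i' * 2 ^+ i') * (mu b - mu a) <=
     3 * (N%:R * 2 ^+ i').
  apply: (le_trans h); have := u01; move: p0 WN.
  have : (0 : R) < 2 ^+ i' by rewrite exprn_gt0.
  set x := 2 ^+ i'; set y := N%:R => x0 yx0 Wy u01'; nra.
rewrite mulrBr -mulrA mulrCA; lra.
Qed.

(** Earlier batches pull [a] at most [N * (1 + 4 + ... + 4 ^ (i - 1))] times, which is the first
    bound. With the current batch this becomes [4 / 3 * N * 4 ^ i], and [(2 ^ i * g) ^ 2 <= 36] for
    the gap [g] yields 48. *)
Lemma count_pulls t i s t0 a : (t <= T)%N -> S t = (i, s, t0) ->
  (a \in s -> 3 * count_mem a (unzip1 (H t0)) + N <= N * 4 ^ i)%N /\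
  (count_mem a (unzip1 (H t)))%:R * (mu b - mu a) ^+ 2 <= 48 * N%:R.
Proof.
have Hdrop t1 t2 : (t1 <= t2)%N -> H t2 = H t1 ++ drop t1 (H t2).
  elim: t2 => [|t2 IH]; first by rewrite leqn0 => /eqP ->.
  rewrite leq_eqVlt => /orP[/eqP ->|]; first by rewrite drop_oversize ?cats0// size_history.
  rewrite ltnS => le12; rewrite /H /= -/(H t2) drop_rcons ?size_history//.
  by rewrite -rcons_cat -IH.
elim: t i s t0 => [|t IH] i s t0 tT.
  by case=> <- _ <-; rewrite expn0 muln0 add0n muln1 mul0r mulr_ge0.
case St : (S t) => [[i' s'] t0'].
have [t0t us tlt dH] := batch_history_inv St.
have bs' := best_active (ltnW tT) St; have s0 : s' != [::] by case: (s') bs'.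
have [IH1 IH2] := IH _ _ _ (ltnW tT) St.
have q_lt : (t - t0' < pulls N i' * size s')%N by rewrite ltn_subLR// tlt.
have cblock : (count_mem a (unzip1 (H t.+1)) <=
    count_mem a (unzip1 (H t0')) + pulls N i' * (a \in s'))%N.
  rewrite (Hdrop t0' t.+1 (leqW t0t)) [unzip1 _]map_cat count_cat leq_add2l.
  have -> : drop t0' (H t.+1) = take (t.+1 - t0') (blocks X (pulls N i') s' t0').
    rewrite (history_step St) drop_rcons ?size_history// dH// subSn//.
    by rewrite (take_nth (a0, 0)) ?size_blocks// (@nth_blocks _ _ X a0)// subnKC.
  rewrite -(count_blocks X _ t0' a us).
  rewrite -[X in (_ <= count_mem _ (unzip1 X))%N](cat_take_drop (t.+1 - t0')).
  by rewrite [in leqRHS]/unzip1 map_cat count_cat leq_addr.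
have c48 : (count_mem a (unzip1 (H t.+1)))%:R * (mu b - mu a) ^+ 2 <= 48 * N%:R.
  (* A dropped arm is not pulled, so its count is unchanged. *)
  have [as'|as'] := boolP (a \in s'); last first.
    rewrite (history_step St) [unzip1 _]map_rcons -cats1 count_cat /=.
    have -> : (nth a0 s' ((t - t0') %/ pulls N i') == a) = false.
      apply/negbTE; apply: contra as' => /eqP <-; exact: pulled_active.
    by rewrite !addn0.
  have := active_gap (ltnW tT) St as'; have := IH1 as'; move: cblock; rewrite as' muln1.
  set c := count_mem a _; set c0 := count_mem a _; rewrite /pulls => cc0 c0N g6.
  have cN : (3 * c <= 4 * (N * 4 ^ i'))%N by lia.
  have {}cN : 3 * c%:R <= 4 * (N%:R * (2 ^+ i' * 2 ^+ i')) :> R.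
    rewrite -exprMn -!natrM -natrX -!natrM ler_nat//.
  have g0 : 0 <= mu b - mu a by rewrite subr_ge0.
  have : (2 ^+ i' * (mu b - mu a)) ^+ 2 <= 36.
    rewrite (_ : 36 = 6 ^+ 2); last by rewrite -natrX.
    by rewrite lerXn2r ?nnegrE ?mulr_ge0 ?exprn_ge0.
  have : (0 : R) <= N%:R by [].
  move: cN g0; set x := 2 ^+ i'; set g := mu b - mu a; set y := N%:R.
  set z := c%:R => cN g0 y0 g36.
  have zg := ler_wpM2r (sqr_ge0 g) cN.
  have yg := ler_wpM2l y0 g36.
  rewrite (_ : 4 * _ * _ = 4 * (y * (x * g) ^+ 2)) in zg; last by ring.
  by lra.
rewrite (batch_history_step St) => Si; split=> // as_.
have as' : a \in s'.
  move: Si as_; case: eqP => [tE|tN] [_ <- _] //.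
  by rewrite mem_filter => /andP[].
have := IH1 as'; move: cblock; rewrite as' muln1.
move: Si; case: eqP => [tE|tN] [<- _ <-] // cblock c0N.
by move: cblock; rewrite /pulls expnS; lia.
Qed.

End GoodRewards.
End Trajectory.

(** By induction both executions have the same batch state and arms, though different rewards. A
    disagreement about an arm would put [pulls N i] times its gap within [2 * W * 2 ^+ i] of the
    threshold. *)
Lemma elimination_replicates {R : realType} {K : nat} (N : nat) (a0 b : 'I_K)
    (X1 X2 : nat -> 'I_K -> R) (xi : nat -> R) (mu : 'I_K -> R) (W : R) (T : nat) :
  (0 < N)%N -> (forall a, 0 <= mu a <= 1) -> (forall a, mu a <= mu b) ->
  0 <= xi 0%N <= 1 -> 2 * W <= N%:R ->
  good_windows N X1 mu W T -> good_windows N X2 mu W T ->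
  (forall i a, (pulls N i <= T)%N ->
     2 * W * 2 ^+ i <
     `|threshold N i (xi 0%N) - (pulls N i)%:R * (mu b - mu a)|) ->
  arms (elimination_policy N a0) X1 xi T = arms (elimination_policy N a0) X2 xi T.
Proof.
move=> N0 mu01 mub u01 WN good1 good2 sep.
pose H X t := history (elimination_policy N a0) X xi t.
pose S X t := batch N (H X t) (xi 0%N) t.
suff main t : (t <= T)%N ->
    S X1 t = S X2 t /\ unzip1 (H X1 t) = unzip1 (H X2 t).
  by have [] := main T (leqnn T).
elim: t => // t IH tT; have [S12 H12] := IH (ltnW tT).
case St2 : (S X2 t) => [[i s] t0]; have St1 := St2; rewrite -S12 in St1.
have [t0t us tlt _] := batch_history_inv N0 St1.
have bs1 := best_active N0 mu01 mub u01 WN good1 (ltnW tT) St1.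
have s0 : s != [::] by case: (s) bs1.
split; last first.
  rewrite /H (history_step St1) (history_step St2) [LHS]map_rcons [RHS]map_rcons.
  by rewrite -/(H X1 t) -/(H X2 t); congr rcons; exact: H12.
rewrite /S (batch_history_step St1) (batch_history_step St2); case: eqP => // tE.
congr (_, _, _); apply: eq_in_filter => a as_.
have h1 := survivors_good N0 mu01 mub u01 WN good1 St1 bs1 as_ tT tE.
have h2 := survivors_good N0 mu01 mub u01 WN good2 St2 bs1 as_ tT tE.
have nT : (pulls N i <= T)%N.
  have ss : (0 < size s)%N by rewrite lt0n size_eq0.
  have n0 := pulls_gt0 N0 i; nia.
have := sep i a nT; rewrite ltr_normr.
move: h1 h2; rewrite !mem_filter as_ !andbT.
case: ifP => k1; case: ifP => k2; rewrite // => h1 h2 /orP[]; lra.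
Qed.

(** * The program *)

Fixpoint block (l : seq instr) : program :=
  if l is i :: l' then Seq (Do i) (block l') else Skip.
Arguments block : simpl never.

(** * Total correctness with step counts *)

Section WeakestPrecondition.
Context {R : realType} {K : nat} (X : nat -> 'I_K -> R) (xi : nat -> R).
Implicit Types (s : state R K) (Q : state R K -> nat -> Prop).

Definition wp (c : program) s Q : Prop := exists s' n, exec X xi c s s' n /\ Q s' n.

Lemma wp_weaken c s Q Q' : (forall s' n, Q s' n -> Q' s' n) -> wp c s Q -> wp c s Q'.
Proof. by move=> QQ' [s' [n [e q]]]; exists s', n; split => //; exact: QQ'. Qed.

Lemma wp_skip s Q : Q s 0%N -> wp Skip s Q.
Proof. by exists s, 0%N; split => //; exact: ExecSkip. Qed.

Lemma wp_seq c1 c2 s Q :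
  wp c1 s (fun s1 n1 => wp c2 s1 (fun s2 n2 => Q s2 (n1 + n2)%N)) ->
  wp (Seq c1 c2) s Q.
Proof.
move=> [s1 [n1 [e1 [s2 [n2 [e2 q]]]]]]; exists s2, (n1 + n2)%N.
by split => //; exact: ExecSeq e1 e2.
Qed.

Lemma wp_if b c1 c2 s Q :
  wp (if eval_test b s then c1 else c2) s (fun s' n => Q s' n.+1) ->
  wp (If b c1 c2) s Q.
Proof. by move=> [s' [n [e q]]]; exists s', n.+1; split => //; exact: ExecIf. Qed.

Fixpoint run_instrs (l : seq instr) s : option (state R K) :=
  if l is i :: l' then
    if run_instr X xi i s is Some s' then run_instrs l' s' else None
  else Some s.

Lemma wp_block l s Q :
  (if run_instrs l s is Some s' then Q s' (size l) else False) ->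
  wp (block l) s Q.
Proof.
elim: l s Q => [|i l IH] s Q /= q; first by exists s, 0%N; split => //; exact: ExecSkip.
case ri : (run_instr X xi i s) q => [s'|] // q.
have [s'' [n [e q']]] := IH s' (fun s n => Q s n.+1) q.
exists s'', n.+1; split=> //; rewrite -add1n.
by apply: ExecSeq e; exact: ExecDo.
Qed.

(* [phi] is a potential that pays for the steps of the remaining iterations. *)
Lemma wp_while b c (Inv : state R K -> Prop) (phi : state R K -> nat) s Q :
  (forall s, Inv s -> eval_test b s ->
     wp c s (fun s' n => Inv s' /\ (n + phi s' < phi s)%N)) ->
  Inv s ->
  (forall s' n, Inv s' -> ~~ eval_test b s' -> (n + phi s' <= phi s + 1)%N ->
     Q s' n) ->
  wp (While b c) s Q.
Proof.
move=> body Is post.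
suff [s' [n [e [Is' b' le_n]]]] : exists s' n, exec X xi (While b c) s s' n /\
    [/\ Inv s', ~~ eval_test b s' & (n + phi s' <= phi s + 1)%N].
  by exists s', n; split => //; exact: post.
have [m le_m] := ubnP (phi s); elim: m s Is le_m {Q post} => // m IH s Is le_m.
case bs : (eval_test b s); last first.
  by exists s, 1%N; split; [apply: ExecWhileStop; rewrite bs|rewrite bs addnC].
have [s1 [n1 [e1 [I1 le1]]]] := body s Is bs.
have [|s' [n [e [Is' b' le_n]]]] := IH s1 I1; first by lia.
exists s', (n1 + n).+1; split; first exact: ExecWhileLoop e.
by split => //; lia.
Qed.

End WeakestPrecondition.

(* Natural cells: 0 horizon, 1 number of arms, 2 number of the next round
   (counted from 1), 3 pulls per arm, 4 arm, 5 address of the data of the arm,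
   6 counter, 7 the constant 1, 8 and 9 first and last address of the data,
   10 scratch, 11 and 12 factors of the sample size, 13 bound on cell 10,
   15 the constant 0, 20 + a whether arm a is active.  Real cells: 0 rho,
   1 threshold, 2 largest sum, 3 scratch, 4 the constant 1, 5 draw,
   20 + a sum of the rewards of arm a. *)
Section Program.
Local Notation D := Dir.

Definition for_arms (body : program) : program :=
  Seq (block [:: NOp NAdd (D 5) (D 8) (D 15)])
      (While (NLe (D 5) (D 9)) (Seq body (block [:: NOp NAdd (D 5) (D 5) (D 7)]))).

(** Once the horizon is exhausted the counter jumps to its last value, so the remaining arms of an
    unfinished batch cost a constant number of steps each. *)
Definition pull_loop : program :=
  While (NLe (D 6) (D 3))
    (Seq (If (NLe (D 2) (D 0))
            (block [:: Pull (D 4) (D 3); ROp RAdd (Ind 5) (Ind 5) (D 3);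
                       NOp NAdd (D 2) (D 2) (D 7)])
            (block [:: NOp NAdd (D 6) (D 3) (D 15)]))
         (block [:: NOp NAdd (D 6) (D 6) (D 7)])).

(** [Ind 5] is the flag of the arm among the naturals and its sum among the reals. The sum is reset
    for inactive arms too, so that they enter the maximum with 0. *)
Definition pull_arm : program :=
  Seq (block [:: RConst (Ind 5) 0])
      (If (NLe (D 7) (Ind 5))
         (Seq (block [:: NConst (D 6) 1; NOp NSub (D 4) (D 5) (D 8)]) pull_loop)
         Skip).

Definition max_arm : program :=
  If (RLe (Ind 5) (D 2)) Skip (block [:: RConst (D 3) 0; ROp RAdd (D 2) (Ind 5) (D 3)]).

Definition drop_arm : program :=
  If (RLe (D 2) (Ind 5)) Skip (block [:: NOp NAdd (Ind 5) (D 15) (D 15)]).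

(** Real cell 2 becomes the largest sum minus the threshold. The final doublings multiply the pulls
    per arm by 4 and the threshold by 2 for the next batch. *)
Definition batch_body : program :=
  Seq (for_arms pull_arm)
 (Seq (block [:: RConst (D 2) 0])
 (Seq (for_arms max_arm)
 (Seq (block [:: ROp RSub (D 2) (D 2) (D 1)])
 (Seq (for_arms drop_arm)
      (block [:: NOp NAdd (D 3) (D 3) (D 3); NOp NAdd (D 3) (D 3) (D 3);
                 ROp RAdd (D 1) (D 1) (D 1)]))))).

End Program.

(** * Correctness of the loops of a batch *)

Section Loops.
Context {R : realType} {K : nat} (X : nat -> 'I_K -> R) (xi : nat -> R).
Implicit Types (s : state R K).

Variable T : nat.
Hypothesis K0 : (0 < K)%N.

Lemma low_cell c k : (c < 20)%N -> (c == 20 + k)%N = false.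
Proof. by move=> c20; apply/negbTE; rewrite neq_ltn (leq_trans c20)// leq_addr. Qed.

Lemma low_cell_sym c k : (c < 20)%N -> (20 + k == c)%N = false.
Proof. by move=> c20; rewrite eq_sym low_cell. Qed.

Lemma arm_sum_rcons (h : seq ('I_K * R)) b r a :
  arm_sum (rcons h (b, r)) a = arm_sum h a + (if b == a then r else 0).
Proof. by rewrite -cats1 arm_sum_cat {2}/arm_sum big_mkcond big_seq1. Qed.

Record consts s : Prop := Consts {
  cell0 : nmem s 0 = T; cell1 : nmem s 1 = K; cell7 : nmem s 7 = 1%N;
  cell8 : nmem s 8 = 20%N; cell9 : nmem s 9 = (K + 19)%N; cell15 : nmem s 15 = 0%N }.

(** Through the potential [phi] pulls are charged to the rounds that remain, so the cost is not [K]
    times that of the longest body. *)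
Lemma wp_for_arms body (I : nat -> state R K -> Prop) (phi : state R K -> nat)
    (B : nat) s (Q : state R K -> nat -> Prop) :
  (forall s v, phi (nset s (Dir 5) v) = phi s) ->
  (forall s k v, I k s -> I k (nset s (Dir 5) v)) ->
  (forall s k, (k < K)%N -> consts s -> I k s -> nmem s 5 = (20 + k)%N ->
    wp X xi body s (fun s' n => [/\ consts s', nmem s' 5 = (20 + k)%N,
       I k.+1 s' & (n + phi s' <= phi s + B)%N])) ->
  consts s -> I 0%N s ->
  (forall s' n, consts s' -> I K s' ->
     (n + phi s' <= phi s + (B + 2) * K + 2)%N -> Q s' n) ->
  wp X xi (for_arms body) s Q.
Proof.
move=> phi5 I5 Hbody cs Is post; apply/wp_seq/wp_block => /=.
pose psi s := (phi s + (B + 2) * (K + 20 - nmem s 5))%N.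
pose J s := consts s /\ exists k, [/\ (k <= K)%N, nmem s 5 = (20 + k)%N & I k s].
apply: (@wp_while _ _ _ _ _ _ J psi).
- move=> s2 [cs2 [k [kK a5 Ik]]] /=; rewrite /nval /= a5 (cell9 cs2) => lk.
  have {}kK : (k < K)%N by lia.
  apply: wp_seq; apply: (wp_weaken _ (Hbody s2 k kK cs2 Ik a5)) => s3 n [cs3 a53 I3 le_n].
  apply: wp_block => /=; split.
    split; first by case: cs3 => *; split.
    exists k.+1; split => //; last exact: I5.
    by rewrite /nval /= a53 (cell7 cs3) addn1 addnS.
  by rewrite /psi -[X in phi X]/(nset s3 (Dir 5) _) phi5 /= /nval /= a53 (cell7 cs3) a5; nia.
- split; first by case: cs => *; split.
  exists 0%N; split => //; last exact: I5.
  by rewrite /= /nval /= (cell8 cs) (cell15 cs).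
move=> s2 n [cs2 [k [kK a5 Ik]]] /=; rewrite /nval /= a5 (cell9 cs2) => lk.
have kE : k = K by lia.
rewrite kE in Ik a5; rewrite /psi phi5 a5 /= /nval /= (cell8 cs) (cell15 cs) => le_n.
by apply: post => //; nia.
Qed.


Variables (N : nat) (a0 : 'I_K).
Hypothesis N0 : (0 < N)%N.

Let u := xi 0%N.
Let H t := history (elimination_policy N a0) X xi t.
Let S t := batch N (H t) u t.

(** For an active arm [k], the number of blocks of pulls that precede its own in the batch. *)
Definition rank (k : nat) (act : seq 'I_K) : nat := count (fun a : 'I_K => (a < k)%N) act.

Lemma rankS (k : 'I_K) act : uniq act -> rank k.+1 act = (rank k act + (k \in act))%N.
Proof.
rewrite /rank; elim: act => //= b act IH /andP[bn ua]; rewrite IH// inE ltnS.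
have [kb|kb] /= := eqVneq k b; first by subst b; rewrite leqnn ltnn (negbTE bn); lia.
have bk : (b == k :> nat) = false by rewrite (inj_eq val_inj) eq_sym (negbTE kb).
by rewrite leq_eqVlt bk addnA.
Qed.

Let ltn_ord_trans : transitive (fun a b : 'I_K => (a < b)%N).
Proof. by move=> b a c; apply: ltn_trans. Qed.

Lemma index_rank (k : 'I_K) act :
  sorted (fun a b : 'I_K => (a < b)%N) act -> k \in act -> index k act = rank k act.
Proof.
rewrite /rank; elim: act => //= b act IH pact; rewrite inE eq_sym.
have /allP b_lt := order_path_min ltn_ord_trans pact.
have [->|kb] /= := eqVneq k b; last first.
  by move=> ka; rewrite b_lt// IH//; exact: path_sorted pact.
move=> _; rewrite ltnn; apply/esym/eqP; rewrite -leqn0 leqNgt -has_count.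
by apply/hasPn => c /b_lt; rewrite -leqNgt => /ltnW.
Qed.

(** The program scans arms by number, the policy by position in the list; the two orders agree
    because the list is increasing. *)
Lemma batch_sorted h t i act t0 : batch N h u t = (i, act, t0) ->
  sorted (fun a b : 'I_K => (a < b)%N) act.
Proof.
elim: t i act t0 => [|t IH] i act t0 /=.
  case=> _ <- _; have := iota_ltn_sorted 0 K.
  by rewrite -val_enum_ord sorted_map.
case E : (batch N h u t) => [[i' act'] t0'].
by case: ifP => _ [_ <- _]; rewrite ?sorted_filter//; exact: IH E.
Qed.

Lemma batch_stable t t0 i act : S t0 = (i, act, t0) -> (t0 <= t)%N ->
  (t < t0 + pulls N i * size act)%N -> S t = (i, act, t0).
Proof.
move=> St0; elim: t => [|t IH]; first by rewrite leqn0 => /eqP <-.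
rewrite leq_eqVlt => /orP[/eqP <- //|]; rewrite ltnS => t0t tlt.
rewrite /S (batch_history_step (IH t0t (ltnW tlt))).
by case: eqP tlt => // ->; rewrite ltnn.
Qed.

Lemma batch_next t0 i act (t := (t0 + pulls N i * size act)%N) :
  S t0 = (i, act, t0) -> act != [::] ->
  S t = (i.+1, survivors (threshold N i u) act (drop t0 (H t)), t).
Proof.
move=> St0 act0; have p0 : (0 < pulls N i * size act)%N.
  by rewrite muln_gt0 pulls_gt0// lt0n size_eq0.
have tE : t = t.-1.+1 by rewrite prednK// addn_gt0 p0 orbT.
have St : S t.-1 = (i, act, t0) by apply: batch_stable => //; rewrite /t; lia.
by rewrite {1}tE /S (batch_history_step St) -tE eqxx.
Qed.

Section Batch.
Variables (i t0 : nat) (act : seq 'I_K).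
Hypothesis St0 : S t0 = (i, act, t0).
Let n := pulls N i.

Record synced s t : Prop := Synced {
  synced_pulled : pulled s = unzip1 (H t) ;
  synced_round : nmem s 2 = t.+1 ;
  synced_horizon : (t <= T)%N ;
  synced_pulls : nmem s 3 = n ;
  synced_threshold : rmem s 1 = threshold N i u ;
  synced_active : forall j : 'I_K, nmem s (20 + j) = (j \in act) }.

(** The second clause is about the history: arms from [k] on are not yet pulled in this batch, so
    resetting the sum of arm [k] to 0 is correct. *)
Definition sums_upto k s t :=
  (forall j : 'I_K, (j < k)%N -> rmem s (20 + j) = arm_sum (drop t0 (H t)) j) /\
  (forall j : 'I_K, (k <= j)%N -> arm_sum (drop t0 (H t)) j = 0).

Definition pulls_left s := (10 * (T.+1 - nmem s 2))%N.

Lemma wp_pull_loop (k : 'I_K) s (Q : state R K -> nat -> Prop) :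
  consts s -> nmem s 5 = (20 + k)%N -> nmem s 4 = k -> nmem s 6 = 1%N ->
  k \in act ->
  (exists t, [/\ synced s t, t = minn T (t0 + n * rank k act) & sums_upto k.+1 s t]) ->
  (forall s' m, consts s' -> nmem s' 5 = (20 + k)%N ->
     (exists t, [/\ synced s' t, t = minn T (t0 + n * (rank k act).+1) &
                    sums_upto k.+1 s' t]) ->
     (m + pulls_left s' <= pulls_left s + 10)%N -> Q s' m) ->
  wp X xi pull_loop s Q.
Proof.
move=> cs a5 a4 a6 ka Is post.
pose Inv s := [/\ consts s, nmem s 5 = (20 + k)%N, nmem s 4 = k &
  exists c t, [/\ nmem s 6 = c.+1, (c <= n)%N, synced s t,
     t = minn T (t0 + n * rank k act + c) & sums_upto k.+1 s t]].
(* The 8 extra units pay for the single iteration that finds the horizon exhausted. *)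
pose phi s := (pulls_left s + 8 * (nmem s 6 <= nmem s 3))%N.
apply: (@wp_while _ _ _ _ _ _ Inv phi).
- move=> {cs a5 a4 a6 Is post}s [cs a5 a4 [c [t [a6 cn sy tE [sums1 sums2]]]]] /=.
  rewrite /nval /= a6 (synced_pulls sy) => c_lt.
  apply/wp_seq/wp_if => /=; rewrite /nval /= (synced_round sy) (cell0 cs).
  have [tT|Tt] := ltnP t T.
    have {}tE : t = (t0 + n * rank k act + c)%N by lia.
    apply: wp_block => /=; rewrite /nval /loc /= a4 insubT //= => kK.
    have -> : Sub (nat_of_ord k) kK = k :> 'I_K by apply: val_inj; exact: SubK.
    have sz : size (pulled s) = t by rewrite (synced_pulled sy) size_map size_history.
    apply: wp_block; rewrite /= /nval /rval /loc /= !a5 /= ?low_cell//=.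
    rewrite (cell7 cs) (synced_round sy) a6 sz.
    have aact := batch_sorted St0; have ik := index_rank aact ka.
    have rk : (rank k act < size act)%N by rewrite -ik index_mem.
    have n0 : (0 < n)%N by exact: pulls_gt0.
    have St : S t = (i, act, t0) by apply: (batch_stable St0); rewrite -/n; nia.
    (* [t - t0] is [n] times the rank of [k] plus [c < n], so the quotient in the policy is the
       position of [k]. *)
    have Ht : H t.+1 = rcons (H t) (k, X t k).
      rewrite /H (history_step St) -/n tE -addnA addKn mulnC divnMDl//.
      by rewrite divn_small// addn0 -ik nth_index// mulnC addnA -tE.
    have Hd : drop t0 (H t.+1) = rcons (drop t0 (H t)) (k, X t k).
      by rewrite Ht drop_rcons// size_history tE -addnA leq_addr.
    split; last first.
      rewrite /phi /pulls_left /= /nval a6 (synced_round sy) (synced_pulls sy) c_lt.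
      by case: (_ <= n)%N; lia.
    split=> //=; first by case: cs => *; split.
    exists c.+1, t.+1; split => //=.
    - by rewrite addn1.
    - case: sy => *; split => //=.
      + by rewrite Ht [unzip1 _]map_rcons; congr rcons.
      + by rewrite addn1.
      + by rewrite a5.
    - by lia.
    - split=> j jk /=; rewrite Hd arm_sum_rcons ?a5.
        rewrite eqn_add2l; have [jk'|jk'] := eqVneq (j : nat) k.
          by rewrite (val_inj jk') eqxx sums1.
        by rewrite sums1// -(inj_eq val_inj) eq_sym (negbTE jk') addr0.
      by rewrite sums2// add0r; case: eqVneq jk => // <-; rewrite ltnn.
  apply: wp_block => /=; rewrite /nval /= (synced_pulls sy) (cell15 cs) addn0.
  apply: wp_block => /=; rewrite /nval /= (cell7 cs).
  have tT : t = T by have := synced_horizon sy; lia.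
  split; last first.
    rewrite /phi /pulls_left /= /nval a6 (synced_round sy) (synced_pulls sy) c_lt.
    have -> : (n + 1 <= n)%N = false by lia.
    by lia.
  split=> //=; first by case: cs => *; split.
  (* The skipped pulls are counted as made: as [t = T], the minimum does not change. *)
  exists n, t; split => //=.
  - by rewrite addn1.
  - by case: sy => *; split.
  - by lia.
- split => //; case: Is => t [sy tE su]; exists 0%N, t; split => //.
  by rewrite addn0.
move=> s' m [cs' a5' a4' [c [t [a6' cn sy tE su]]]] /=.
rewrite /nval /= a6' (synced_pulls sy) -ltnNge ltnS => nc le_m.
apply: post => //.
  exists t; split => //; rewrite tE mulnS (_ : c = n); last by lia.
  by rewrite addnA addnAC.
rewrite /phi a6' (synced_pulls sy) in le_m; lia.
Qed.

Lemma wp_pull_arm (k : 'I_K) s (Q : state R K -> nat -> Prop) :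
  consts s -> nmem s 5 = (20 + k)%N ->
  (exists t, [/\ synced s t, t = minn T (t0 + n * rank k act) & sums_upto k s t]) ->
  (forall s' m, consts s' -> nmem s' 5 = (20 + k)%N ->
     (exists t, [/\ synced s' t, t = minn T (t0 + n * rank k.+1 act) &
                    sums_upto k.+1 s' t]) ->
     (m + pulls_left s' <= pulls_left s + 20)%N -> Q s' m) ->
  wp X xi pull_arm s Q.
Proof.
move=> cs a5 [t [sy tE [su1 su2]]] post.
apply/wp_seq/wp_block => /=.
set s1 := rset _ _ _.
have cs1 : consts s1 by case: cs => *; split.
have sy1 : synced s1 t.
  by case: sy => *; split => //=; rewrite /loc /= ?a5 ?low_cell.
have su' : sums_upto k.+1 s1 t.
  split=> j jk /=; last by rewrite su2// ltnW.
  rewrite /loc a5 eqn_add2l; have [jk'|jk'] := eqVneq (j : nat) k.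
    by rewrite rmorph0 su2// jk'.
  by rewrite su1// ltn_neqAle jk' -ltnS.
have rS : rank k.+1 act = (rank k act + (k \in act))%N.
  by apply: rankS; have [] := batch_history_inv N0 St0.
apply: wp_if => /=; rewrite /nval /= a5 (synced_active sy) (cell7 cs).
case: (boolP (k \in act)) => ka /=; last first.
  apply: wp_skip.
  apply: post => //; last by rewrite /pulls_left /=; lia.
  by exists t; split => //; rewrite rS (negbTE ka) addn0.
apply/wp_seq/wp_block; rewrite /=.
apply: (@wp_pull_loop k) => //=.
- by case: cs1 => *; split.
- by rewrite /nval /= a5 (cell8 cs) addKn.
- by exists t; split => //; case: sy1 => *; split.
move=> s' m cs' a5' I' le_m; apply: post => //; first by rewrite rS ka addn1.
by move: le_m; rewrite /pulls_left /=; lia.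
Qed.

Lemma wp_pull_phase s (Q : state R K -> nat -> Prop) :
  consts s -> synced s t0 ->
  (forall s' t m, consts s' -> synced s' t ->
     t = minn T (t0 + n * size act) ->
     (forall j : 'I_K, rmem s' (20 + j) = arm_sum (drop t0 (H t)) j) ->
     (m + 10 * t0 <= 10 * t + 22 * K + 2)%N -> Q s' m) ->
  wp X xi (for_arms pull_arm) s Q.
Proof.
move=> cs sy post.
apply: (@wp_for_arms _ (fun k s => exists t, [/\ synced s t,
   t = minn T (t0 + n * rank k act) & sums_upto k s t]) pulls_left 20) => //.
- move=> s' v k [t [sy' tE su]]; exists t; split => //.
  by case: sy' => *; split.
- move=> s' k kK cs' Is' a5; apply: (@wp_pull_arm (Ordinal kK)) => //.
- exists t0; split => //.
    have -> : rank 0 act = 0%N.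
      by apply/eqP; rewrite -leqn0 leqNgt -has_count -all_predC; apply/allP.
    by rewrite muln0 addn0; apply/esym/minn_idPr; exact: synced_horizon sy.
  split=> // j _; rewrite drop_oversize ?size_history//.
  by rewrite /arm_sum big_nil.
move=> s' m cs' [t [sy' tE [su _]]].
have rK : rank K act = size act by apply/eqP; rewrite -all_count; apply/allP => j _ /=.
rewrite /pulls_left (synced_round sy) (synced_round sy') => le_m.
apply: (post s' t) => //; first by rewrite tE rK.
  by move=> j; exact: su.
by have := synced_horizon sy'; have := synced_horizon sy; lia.
Qed.

(** What the comparison phases preserve; the flags are stated apart because [drop_arm] changes
    them. *)
Record settled s t : Prop := Settled {
  settled_pulled : pulled s = unzip1 (H t) ;
  settled_round : nmem s 2 = t.+1 ;
  settled_pulls : nmem s 3 = n ;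
  settled_threshold : rmem s 1 = threshold N i u ;
  settled_sum : forall j : 'I_K, rmem s (20 + j) = arm_sum (drop t0 (H t)) j }.

Lemma wp_max_phase s t (Q : state R K -> nat -> Prop) :
  consts s -> settled s t -> rmem s 2 = 0 ->
  (forall j : 'I_K, nmem s (20 + j) = (j \in act)) ->
  (forall s' m, consts s' -> settled s' t ->
     rmem s' 2 = top_sum (drop t0 (H t)) ->
     (forall j : 'I_K, nmem s' (20 + j) = (j \in act)) ->
     (m <= 22 * K + 2)%N -> Q s' m) ->
  wp X xi (for_arms max_arm) s Q.
Proof.
move=> cs se r2 ac post; pose f := arm_sum (drop t0 (H t)).
apply: (@wp_for_arms _ (fun k s => [/\ settled s t,
   forall j : 'I_K, nmem s (20 + j) = (j \in act), 0 <= rmem s 2,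
   forall j : 'I_K, (j < k)%N -> f j <= rmem s 2 &
   rmem s 2 = 0 \/ exists j, rmem s 2 = f j]) (fun=> 0%N) 20) => //.
- by move=> s' v k [se' ac' r0 rj rE]; split => //; case: se' => *; split.
- move=> s' k kK cs' [se' ac' r0 rj rE] a5.
  have sk : rmem s' (20 + k) = f (Ordinal kK) by exact: (settled_sum se' (Ordinal kK)).
  apply: wp_if; rewrite /= /rval /= a5 sk; case: ifPn => fk.
    apply: wp_skip; split => //; split => // j.
    rewrite ltnS leq_eqVlt => /orP[/eqP jk|]; last exact: rj.
    by rewrite (_ : j = Ordinal kK)//; exact: val_inj.
  move: fk; rewrite -ltNge => /ltW fk.
  apply: wp_block; rewrite /= /rval /= a5 low_cell_sym// sk rmorph0 addr0.
  split => //=; first by case: cs' => *; split.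
  split => //=.
  - case: se' => *; split => //= j; rewrite !low_cell_sym//.
  - by exact: le_trans fk.
  - move=> j; rewrite ltnS leq_eqVlt => /orP[/eqP jk|/rj h].
      by rewrite (_ : j = Ordinal kK)//; exact: val_inj.
    exact: le_trans h fk.
  - by right; exists (Ordinal kK).
- by rewrite r2; split => //; left.
move=> s' m cs' [se' ac' r0 rj rE]; rewrite addn0 add0n => le_m.
apply: post => //; apply/eqP; rewrite eq_le; apply/andP; split.
  by case: rE => [->|[j ->]]; rewrite /top_sum ?bigmax_ge_id// le_bigmax.
by apply/bigmax_leP; split => // j _; exact: rj.
Qed.

Lemma wp_drop_phase s t (Q : state R K -> nat -> Prop) :
  consts s -> settled s t ->
  (forall j : 'I_K, nmem s (20 + j) = (j \in act)) ->
  (forall s' m, consts s' -> settled s' t ->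
     (forall j : 'I_K, nmem s' (20 + j) =
        (j \in act) && (rmem s 2 <= arm_sum (drop t0 (H t)) j)) ->
     (m <= 22 * K + 2)%N -> Q s' m) ->
  wp X xi (for_arms drop_arm) s Q.
Proof.
move=> cs se ac post; pose f := arm_sum (drop t0 (H t)).
apply: (@wp_for_arms _ (fun k s' => [/\ settled s' t, rmem s' 2 = rmem s 2 &
   forall j : 'I_K, nmem s' (20 + j) =
     (j \in act) && ((k <= j)%N || (rmem s 2 <= f j))]) (fun=> 0%N) 20) => //.
- by move=> s' v k [se' r2 ac']; split => //; case: se' => *; split.
- move=> s' k kK cs' [se' r2 ac'] a5.
  have sk : rmem s' (20 + k) = f (Ordinal kK) by exact: (settled_sum se' (Ordinal kK)).
  have split_le (j : 'I_K) : (j : nat) != k -> (k <= j)%N = (k < j)%N.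
    by move=> jk; rewrite leq_eqVlt eq_sym (negbTE jk).
  apply: wp_if; rewrite /= /rval /= a5 sk r2; case: ifPn => fk.
    apply: wp_skip; split => //; split => // j; rewrite ac'.
    have [jk|/split_le -> //] := eqVneq (j : nat) k.
    have -> : j = Ordinal kK by exact: val_inj.
    by rewrite fk !orbT.
  apply: wp_block; rewrite /= /nval /= (cell15 cs').
  split => //=.
  - by case: cs' => *; split; rewrite /= /loc /= a5 low_cell.
  - by rewrite a5 low_cell.
  split => //=.
    by case: se' => *; split; rewrite //= /loc /= a5 low_cell.
  move=> j; rewrite a5 eqn_add2l; have [jk|/split_le <- //] := eqVneq (j : nat) k.
  have -> : j = Ordinal kK by exact: val_inj.
  by rewrite ltnn /= (negbTE fk) andbF.
- by split => // j; rewrite ac /= andbT.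
move=> s' m cs' [se' r2 ac']; rewrite addn0 add0n => le_m.
by apply: post => // j; rewrite ac' leqNgt ltn_ord.
Qed.

(** If the horizon cuts the batch, the program compares incomplete sums, but no pull follows; hence
    the new state is described for [t < T] only. At least one round is played, and it will pay for
    the scans of the arms. *)
Lemma wp_batch_body s (Q : state R K -> nat -> Prop) :
  (t0 < T)%N -> act != [::] -> consts s -> synced s t0 ->
  (forall s' t m, consts s' -> pulled s' = unzip1 (H t) -> nmem s' 2 = t.+1 ->
     (t0 < t <= T)%N ->
     ((t < T)%N -> [/\ t = (t0 + n * size act)%N, nmem s' 3 = (4 * n)%N,
        rmem s' 1 = 2 * threshold N i u &
        forall j : 'I_K, nmem s' (20 + j) =
          (j \in survivors (threshold N i u) act (drop t0 (H t)))]) ->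
     (m + 10 * t0 <= 10 * t + 100 * K)%N -> Q s' m) ->
  wp X xi batch_body s Q.
Proof.
move=> t0T act0 cs sy post.
apply: wp_seq; apply: wp_pull_phase => // s1 t n1 cs1 sy1 tE su le1.
have n0 : (0 < n * size act)%N by rewrite muln_gt0 pulls_gt0// lt0n size_eq0.
have se1 : settled s1 t by case: sy1 => *; split.
apply/wp_seq/wp_block => /=; apply: wp_seq.
apply: (@wp_max_phase _ t) => //=.
- by case: cs1 => *; split.
- by case: se1 => *; split => //= j; rewrite low_cell_sym.
- by rewrite rmorph0.
- exact: synced_active sy1.
move=> s2 n2 cs2 se2 r2 ac2 le2.
apply/wp_seq/wp_block => /=; apply: wp_seq.
apply: (@wp_drop_phase _ t) => //=.
- by case: cs2 => *; split.
- by case: se2 => *; split => //= j; rewrite low_cell_sym.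
move=> s3 n3 cs3 se3; rewrite /rval /= r2 (settled_threshold se2) => ac3 le3.
apply: wp_block => /=; apply: (post _ t) => //=.
- by case: cs3 => *; split.
- exact: settled_pulled se3.
- exact: settled_round se3.
- by rewrite (synced_horizon sy1) andbT tE; lia.
- move=> tT; split=> //.
  + by lia.
  + by rewrite /nval /= (settled_pulls se3); lia.
  + by rewrite /rval /= (settled_threshold se3) mulr2n mulrDl mul1r.
  + by move=> j; rewrite ?low_cell_sym// ac3 mem_filter andbC.
by lia.
Qed.

End Batch.
End Loops.

Section Nonempty.
Context {R : realType} {K : nat} (N : nat) (a0 : 'I_K).
Variables (X : nat -> 'I_K -> R) (xi : nat -> R).
Hypothesis N0 : (0 < N)%N.
Hypothesis X0 : forall t a, 0 <= X t a.
Hypothesis u0 : 0 <= xi 0%N.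

(** The arm with the largest sum survives since thresholds are nonnegative. Accuracy is not assumed:
    the program must follow the policy for all rewards in [0, 1]. *)
Lemma active_nonempty t i act t0 :
  batch N (history (elimination_policy N a0) X xi t) (xi 0%N) t = (i, act, t0) ->
  act != [::].
Proof.
elim: t i act t0 => [|t IH] i act t0.
  case=> _ <- _; rewrite -size_eq0 size_enum_ord -lt0n.
  exact: leq_ltn_trans (ltn_ord a0).
case St : (batch N (history (elimination_policy N a0) X xi t) (xi 0%N) t)
  => [[i' act'] t0'].
have act0 := IH _ _ _ St.
rewrite (batch_history_step St); case: eqP => [tE|_] [_ <- _] //.
rewrite (batch_end N0 St)//.
have [a1 a1act] : exists a, a \in act'.
  by case: (act') act0 => // a l _; exists a; rewrite inE eqxx.
pose f := arm_sum (blocks X (pulls N i') act' t0').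
have f0 a : 0 <= f a.
  have [_ us _ _] := batch_history_inv N0 St; rewrite /f.
  have [aa|aa] := boolP (a \in act').
    by rewrite arm_sum_blocks// sumr_ge0.
  by rewrite arm_sum_blocks_notin.
case: (@arg_maxP _ _ _ a1 (mem act') f a1act) => a aact amax.
suff : a \in survivors (threshold N i' (xi 0%N)) act' (blocks X (pulls N i') act' t0').
  by case: survivors.
rewrite mem_filter [a \in act']aact andbT lerBlDr.
apply: (@le_trans _ _ (f a)); last by rewrite lerDl mulr_ge0// addr_ge0.
apply/bigmax_leP; split => // b _.
have [bb|bb] := boolP (b \in act'); first exact: amax.
by rewrite arm_sum_blocks_notin.
Qed.

End Nonempty.

(** * The sample size, in a form that the machine can compute *)

Section SampleSize.
Context {R : realType}.

(** An integer substitute for [1 / rho]: the least [m] with [m * rho > 1], found by repeated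
    addition. *)
Definition accuracy (rho : R) : nat := (Num.truncn rho^-1).+1.

(** An integer substitute for [log (T * K)]: the number of binary digits, found by doubling. *)
Definition bit_length (T K : nat) : nat := (trunc_log 2 (T * K)).+1.

(** With [M] and [L] the two integers above, [128 * 128 = 16 * 1024] comes from a tolerated
    deviation [1024 L M K] and a ratio [16 M K] of the sample size to it. *)
Definition sample_size (T K : nat) (rho : R) : nat :=
  (accuracy rho * K * (accuracy rho * K) * bit_length T K * 128 * 128)%N.

Lemma accuracyP (rho : R) m : 0 < rho -> (m%:R * rho <= 1) = (m < accuracy rho)%N.
Proof.
move=> r0; rewrite ltnS truncn_ge_nat; last by rewrite invr_ge0 ltW.
by rewrite -ler_pdivlMr// mul1r.
Qed.

Lemma bit_lengthP T K l : (0 < T)%N -> (0 < K)%N ->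
  (2 ^ l <= T * K)%N = (l < bit_length T K)%N.
Proof.
move=> T0 K0; have TK : (0 < T * K)%N by rewrite muln_gt0 T0.
rewrite ltnS; apply/idP/idP => h; first exact: trunc_log_max.
by apply: (leq_trans _ (trunc_logP (isT : 1 < 2)%N TK)); rewrite leq_exp2l.
Qed.

End SampleSize.

Section MainProgram.
Local Notation D := Dir.

(** The memory is zero at the start: the counters 11 and 12, the constant 15 and real cell 3 rely on
    it. *)
Definition main_program : program :=
  Seq (block [:: NConst (D 7) 1; NConst (D 8) 20; NConst (D 9) 19;
                 NOp NAdd (D 9) (D 1) (D 9); ROfNat (D 4) (D 7)])
 (Seq (While (RLe (D 3) (D 4))
         (block [:: NOp NAdd (D 12) (D 12) (D 7); ROp RAdd (D 3) (D 3) (D 0)]))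
 (Seq (block [:: NOp NMul (D 13) (D 0) (D 1); NOp NAdd (D 10) (D 7) (D 15)])
 (Seq (While (NLe (D 10) (D 13))
         (block [:: NOp NAdd (D 10) (D 10) (D 10); NOp NAdd (D 11) (D 11) (D 7)]))
 (Seq (block [:: NOp NMul (D 12) (D 12) (D 1); NOp NMul (D 3) (D 12) (D 12);
                 NOp NMul (D 3) (D 3) (D 11); NConst (D 10) 128;
                 NOp NMul (D 3) (D 3) (D 10); NOp NMul (D 3) (D 3) (D 10);
                 Draw (D 5); ROp RAdd (D 5) (D 4) (D 5); ROfNat (D 1) (D 3);
                 ROp RMul (D 1) (D 1) (D 5); NOp NAdd (D 2) (D 7) (D 15)])
 (Seq (for_arms (block [:: NOp NAdd (Ind 5) (D 7) (D 15)]))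
      (While (NLe (D 2) (D 0)) batch_body)))))).

End MainProgram.

Section Implementation.
Context {R : realType} {K : nat} (T : nat) (rho : R) (a0 : 'I_K).
Variables (X : nat -> 'I_K -> R) (xi : nat -> R).
Hypothesis T0 : (0 < T)%N.
Hypothesis rho0 : 0 < rho.
Hypothesis X0 : forall t a, 0 <= X t a.
Hypothesis u0 : 0 <= xi 0%N.

Let K0 : (0 < K)%N. Proof. exact: leq_ltn_trans (ltn_ord a0). Qed.
Let N := sample_size T K rho.
Let N0 : (0 < N)%N.
Proof. by rewrite /N /sample_size !muln_gt0 K0. Qed.
Let u := xi 0%N.
Let H t := history (elimination_policy N a0) X xi t.
Let S t := batch N (H t) u t.

Record fresh (s : state R K) : Prop := Fresh {
  fresh_consts : consts T s ;
  fresh_rho : rmem s 0 = rho ;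
  fresh_one : rmem s 4 = 1 ;
  fresh_drawn : drawn s = 0%N ;
  fresh_pulled : pulled s = [::] }.

Lemma wp_accuracy s (Q : state R K -> nat -> Prop) :
  fresh s -> nmem s 12 = 0%N -> rmem s 3 = 0 -> nmem s 11 = 0%N ->
  (forall s' m, fresh s' -> nmem s' 12 = accuracy rho -> nmem s' 11 = 0%N ->
     (m <= 3 * accuracy rho + 1)%N -> Q s' m) ->
  wp X xi (While (RLe (Dir 3) (Dir 4))
         (block [:: NOp NAdd (Dir 12) (Dir 12) (Dir 7);
                    ROp RAdd (Dir 3) (Dir 3) (Dir 0)])) s Q.
Proof.
move=> fs m0 r0 l0 post.
apply: (@wp_while _ _ _ _ _ _ (fun s => [/\ fresh s, nmem s 11 = 0%N,
   (nmem s 12 <= accuracy rho)%N & rmem s 3 = (nmem s 12)%:R * rho])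
   (fun s => (3 * (accuracy rho - nmem s 12))%N)).
- move=> {fs m0 r0 l0 post}s [fs l0 le_m r3] /=.
  rewrite /rval /= r3 (fresh_one fs) accuracyP// => lt_m.
  apply: wp_block; rewrite /= /nval /rval /= (cell7 (fresh_consts fs)).
  split; last by lia.
  split => //=; last 2 first.
  - by lia.
  - by rewrite r3 (fresh_rho fs) addn1 -natr1 mulrDl mul1r.
  by case: fs => -[] *; split => //; split.
- by split => //; rewrite ?m0// r0 mul0r.
move=> s' m [fs' l0' le_m r3] /=.
rewrite /rval /= r3 (fresh_one fs') accuracyP// -leqNgt => ge_m; rewrite m0 => le.
by apply: post => //; lia.
Qed.

Lemma wp_bit_length s (Q : state R K -> nat -> Prop) :
  fresh s -> nmem s 11 = 0%N -> nmem s 10 = 1%N -> nmem s 13 = (T * K)%N ->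
  nmem s 12 = accuracy rho ->
  (forall s' m, fresh s' -> nmem s' 12 = accuracy rho ->
     nmem s' 11 = bit_length T K ->
     (m <= 3 * bit_length T K + 1)%N -> Q s' m) ->
  wp X xi (While (NLe (Dir 10) (Dir 13))
         (block [:: NOp NAdd (Dir 10) (Dir 10) (Dir 10);
                    NOp NAdd (Dir 11) (Dir 11) (Dir 7)])) s Q.
Proof.
move=> fs l0 p1 TK acc post.
apply: (@wp_while _ _ _ _ _ _ (fun s => [/\ fresh s, nmem s 12 = accuracy rho,
   nmem s 13 = (T * K)%N, (nmem s 11 <= bit_length T K)%N &
   nmem s 10 = (2 ^ nmem s 11)%N])
   (fun s => (3 * (bit_length T K - nmem s 11))%N)).
- move=> {fs l0 p1 TK acc post}s [fs acc TK le_l p2] /=.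
  rewrite /nval /= p2 TK bit_lengthP// => lt_l.
  apply: wp_block; rewrite /= /nval /= (cell7 (fresh_consts fs)).
  split; last by lia.
  split => //=; last 2 first.
  - by lia.
  - by rewrite p2 addn1 expnS mul2n addnn.
  by case: fs => -[] *; split => //; split.
- by split => //; rewrite ?l0// expn0.
move=> s' m [fs' acc' TK' le_l p2] /=.
rewrite /nval /= p2 TK' bit_lengthP// -leqNgt => ge_l; rewrite l0 => le.
by apply: post => //; lia.
Qed.

Lemma wp_activate s (Q : state R K -> nat -> Prop) :
  consts T s -> pulled s = [::] -> nmem s 2 = 1%N -> nmem s 3 = N ->
  rmem s 1 = threshold N 0 u ->
  (forall s' m, consts T s' ->
     synced X xi T N a0 0 (enum 'I_K) s' 0 -> (m <= 5 * K + 2)%N -> Q s' m) ->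
  wp X xi (for_arms (block [:: NOp NAdd (Ind 5) (Dir 7) (Dir 15)])) s Q.
Proof.
move=> cs p0 r1 n3 th post.
apply: (wp_for_arms (T := T) K0 (I := fun k s => [/\ pulled s = [::], nmem s 2 = 1%N, nmem s 3 = N,
     rmem s 1 = threshold N 0 u &
     forall j : 'I_K, (j < k)%N -> nmem s (20 + j) = 1%N])
  (phi := fun=> 0%N) (B := 3)) => //.
  move=> s' k kK cs' [p0' r1' n3' th' ac] a5.
  apply: wp_block; rewrite /= /nval /= (cell7 cs') (cell15 cs').
  split => //=.
  - by case: cs' => *; split; rewrite /= /loc /= a5 low_cell.
  - by rewrite a5 low_cell.
  split; rewrite //= ?a5 ?low_cell// => j.
  by rewrite eqn_add2l ltnS leq_eqVlt => /orP[->//|/ac ->]; case: ifP.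
move=> s' m cs' [p0' r1' n3' th' ac]; rewrite addn0 add0n => le_m.
apply: post => //; split => //; first by rewrite n3' /pulls muln1.
by move=> j; rewrite ac ?mem_enum.
Qed.

Lemma wp_batches s (Q : state R K -> nat -> Prop) :
  consts T s -> synced X xi T N a0 0 (enum 'I_K) s 0 ->
  (forall s' m, pulled s' = unzip1 (H T) -> (m <= 200 * (K * T) + 1)%N -> Q s' m) ->
  wp X xi (While (NLe (Dir 2) (Dir 0)) batch_body) s Q.
Proof.
move=> cs sy post.
(* A batch costs at most 10 steps per round plus [100 * K] and plays at least one round, so
   [200 * K] per remaining round pays for it. *)
apply: (@wp_while _ _ _ _ _ _ (fun s => consts T s /\
   exists t, [/\ pulled s = unzip1 (H t), nmem s 2 = t.+1, (t <= T)%N &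
     (t < T)%N -> exists i act, S t = (i, act, t) /\
        synced X xi T N a0 i act s t])
   (fun s => (200 * K * (T.+1 - nmem s 2))%N)).
- move=> {cs sy post}s [cs [t [pt r2 tT next]]] /=.
  rewrite /nval /= r2 (cell0 cs) => lt_tT.
  have [i [act [St sy]]] := next lt_tT.
  have act0 := active_nonempty N0 X0 u0 St.
  apply: (wp_batch_body (T := T) K0 N0 St) => // s' t' m cs' pt' r2' /andP[tt' t'T] next' le_m.
  split; last first.
    rewrite r2' !subSS (_ : T - t = (T - t') + (t' - t))%N; last by lia.
    by nia.
  split => //; exists t'; split => // lt_t'T.
  have [tE n3 th ac] := next' lt_t'T.
  exists i.+1, (survivors (threshold N i u) act (drop t (H t'))); split.
    by rewrite tE; exact: batch_next.
  split => //; first by rewrite n3 /pulls expnS; lia.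
  by rewrite th /threshold expnS !natrM; ring.
- split => //; exists 0%N; split => //.
  + exact: synced_pulled sy.
  + exact: synced_round sy.
  + by move=> _; exists 0%N, (enum 'I_K).
move=> s' m [cs' [t [pt r2 tT _]]] /=; rewrite /nval /= r2 (cell0 cs') -leqNgt => Tt.
have tE : t = T by apply/eqP; rewrite eqn_leq tT.
rewrite (synced_round sy) => le_m; apply: post; first by rewrite pt tE.
by nia.
Qed.

Lemma wp_main_program (Q : state R K -> nat -> Prop) :
  (forall s' m, pulled s' = unzip1 (H T) ->
     (m <= 3 * accuracy rho + 3 * bit_length T K + 5 * K + 200 * (K * T) + 30)%N ->
     Q s' m) ->
  wp X xi main_program (input_state K T rho) Q.
Proof.
move=> post; apply/wp_seq/wp_block => /=; apply: wp_seq.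
apply: wp_accuracy => //=.
move=> s1 m1 fs1 acc1 l1 le1.
apply/wp_seq/wp_block => /=; rewrite /nval /= (cell7 (fresh_consts fs1)) (cell15 (fresh_consts fs1)).
apply: wp_seq; apply: wp_bit_length => //=.
- by case: fs1 => -[] *; split => //; split.
- by rewrite (cell0 (fresh_consts fs1)) (cell1 (fresh_consts fs1)).
move=> s2 m2 fs2 acc2 l2 le2.
apply/wp_seq/wp_block => /=; rewrite /nval /rval /=.
rewrite acc2 l2 (cell1 (fresh_consts fs2)) (cell7 (fresh_consts fs2)) (cell15 (fresh_consts fs2)).
rewrite (fresh_one fs2) (fresh_drawn fs2) -/(sample_size T K rho) -/N.
apply: wp_seq; apply: wp_activate => //=.
- by case: fs2 => -[] *; split.
- exact: fresh_pulled fs2.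
- by rewrite /threshold expn0 muln1.
move=> s3 m3 cs3 sy3 le3; apply: wp_batches => // s4 m4 p4 le4.
by apply: post => //; lia.
Qed.

End Implementation.

Lemma main_program_implements {R : realType} (K T : nat) (rho : R) (a0 : 'I_K) :
  (0 < T)%N -> 0 < rho <= 1 ->
  implements_within T rho main_program (elimination (sample_size T K rho) a0)
    (300%:R * (K%:R * T%:R / rho) ^+ 1).
Proof.
move=> T0 /andP[rho0 rho1] X xi X01 xi01.
have X0 t a : 0 <= X t a by have /andP[] := X01 t a.
have u0 : 0 <= xi 0%N by have /andP[] := xi01 0%N.
suff [s [n [e [p le_n]]]] : wp X xi main_program (input_state K T rho)
    (fun s n => pulled s = arms (elimination (sample_size T K rho) a0) X xi T /\
       n%:R <= 300%:R * (K%:R * T%:R / rho) ^+ 1) by exists s, n.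
apply: (@wp_main_program _ _ _ _ a0) => // s m p le_m; split=> //.
have K0 : (0 < K)%N by exact: leq_ltn_trans (ltn_ord a0).
have KT0 : (0 < T * K)%N by rewrite muln_gt0 T0.
have le_l : (bit_length T K <= (K * T).+1)%N.
  have h1 := trunc_logP (isT : 1 < 2)%N KT0.
  have h2 := ltn_expl (trunc_log 2 (T * K)) (isT : 1 < 2)%N.
  by rewrite /bit_length ltnS (mulnC K); exact: leq_trans (ltnW h2) h1.
have {le_m le_l} le_m : (m <= 3 * accuracy rho + 250 * (K * T))%N.
  have : (K <= K * T)%N by rewrite leq_pmulr.
  by move: KT0; rewrite (mulnC T) => KT0; lia.
have r1 : 1 <= rho^-1 by rewrite invr_ge1// unitfE gt_eqF.
have le_acc : (accuracy rho)%:R <= 1 + rho^-1 :> R.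
  by rewrite /accuracy -natr1 addrC lerD2l truncn_le// invr_ge0 ltW.
have KT1 : 1 <= K%:R * T%:R :> R by rewrite -natrM ler1n mulnC.
rewrite expr1.
apply: (@le_trans _ _ (3 * (accuracy rho)%:R + 250 * (K%:R * T%:R))).
  by rewrite -!natrM -natrD ler_nat.
have h1 : rho^-1 <= K%:R * T%:R / rho by rewrite ler_peMl// invr_ge0 ltW.
have h2 : K%:R * T%:R <= K%:R * T%:R / rho by rewrite ler_peMr// mulr_ge0.
by move: h1 h2 le_acc KT1; set x := K%:R * T%:R; set y := x / rho; set z := rho^-1; lra.
Qed.

(** * Replicability and regret *)

Section FiniteUnion.
Context {R : realType} {d} {Om : measurableType d} (P : probability Om R).

Lemma measure_bigsetU_le {I : Type} (s : seq I) (F : I -> set Om) (c : R) :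
  (forall i, measurable (F i)) -> (forall i, (P (F i) <= c%:E)%E) ->
  measurable (\big[setU/set0]_(i <- s) F i) /\
  (P (\big[setU/set0]_(i <- s) F i) <= ((size s)%:R * c)%:E)%E.
Proof.
move=> mF PF; elim: s => [|i s [IH1 IH2]].
  by rewrite !big_nil measure0 mul0r; split => //; exact: measurable0.
rewrite !big_cons; split; first exact: measurableU.
apply: (le_trans (measureU2 _ (mF i) IH1)).
by rewrite /= -natr1 mulrDl mul1r addrC EFinD leeD.
Qed.

End FiniteUnion.

(** * Numerical relations between the parameters *)

Section Constants.
Context {R : realType}.
Variables (T K : nat) (rho : R).
Hypothesis T2 : (2 <= T)%N.
Hypothesis K0 : (0 < K)%N.

Let M := accuracy rho.
Let L := bit_length T K.
Let N := sample_size T K rho.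

Definition sample_deviation : R := (1024 * L * (M * K))%:R.
Local Notation W := sample_deviation.

Lemma sample_size_deviation : N%:R = 16 * (M * K)%:R * W.
Proof. by rewrite /N /sample_size /W !natrM; ring. Qed.

Lemma sample_size_gt0 : (0 < N)%N.
Proof. by rewrite /N /sample_size !muln_gt0 K0. Qed.

Lemma deviation_le : 2 * W <= N%:R.
Proof.
rewrite sample_size_deviation ler_wpM2r ?ler0n//.
have : (1 : R) <= (M * K)%:R by rewrite ler1n muln_gt0 K0.
by lra.
Qed.

(** The squared deviation and the number of pulls both grow by the factor 4 per batch, so one
    exponent serves all batches; the factor 1024 in the deviation makes it [8 L]. *)
Lemma hoeffding_exponent i :
  (W * 2 ^+ i) ^+ 2 / (8 * (pulls N i)%:R) = 8 * L%:R.
Proof.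
have p0 : (pulls N i)%:R != 0 :> R by rewrite pnatr_eq0 -lt0n pulls_gt0 ?sample_size_gt0.
apply: (canLR (mulfK _)); first by rewrite mulf_neq0// pnatr_eq0.
have E4 : (4%:R : R) ^+ i = 2 ^+ i * 2 ^+ i by rewrite -exprMn -natrM.
by rewrite /pulls natrM natrX E4 sample_size_deviation /W !natrM; ring.
Qed.

Lemma bit_length_gt : (T * K < 2 ^ L)%N.
Proof.
by have := @bit_lengthP T K L (ltnW T2) K0; rewrite ltnn leqNgt => /negbFE.
Qed.

(** [T * T * K] counts the windows by start, batch and arm. As [2 ^ L > T K], the exponential of
    [8 L] is at least [(T K) ^ 8], which exceeds [8 T^3 K] because [T ^ 3 >= 8]. *)
Lemma expR_bit_length :
  (T * T * K)%:R * (2 * expR (- (8 * L%:R))) <= 1 / (4 * T%:R) :> R.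
Proof.
have T0 : (0 : R) < T%:R by rewrite ltr0n ltnW.
have e2 : (2 : R) <= expR 1 by have := expR_ge1Dx (1 : R); lra.
have le1 : (T * K)%:R ^+ 8 <= expR (8 * L%:R) :> R.
  rewrite (expRM_natl 8) lerXn2r ?nnegrE ?expR_ge0//.
  apply: (@le_trans _ _ (2 ^+ L)); first by rewrite -natrX ler_nat ltnW// bit_length_gt.
  by rewrite -[L%:R]mulr1 expRM_natl lerXn2r ?nnegrE ?expR_ge0.
have E0 : (0 : R) < expR (8 * L%:R) by exact: expR_gt0.
rewrite expRN mulrA ler_pdivrMr// [leRHS]mulrAC mul1r ler_pdivlMr ?mulr_gt0//.
apply: le_trans _ le1.
rewrite [leLHS](_ : _ = (8 * (T * T * T * K))%:R); last by rewrite !natrM; ring.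
rewrite -natrX ler_nat.
have h8 : (8 <= T * T * T)%N by nia.
have TK1 : (0 < T * K)%N by nia.
apply: (@leq_trans ((T * T * T) * (T * T * T * K))%N); first by rewrite leq_mul2r h8 orbT.
rewrite (_ : (T * T * T * (T * T * T * K) = (T * K) * T ^ 5)%N); last first.
  by rewrite !expnS expn0; lia.
rewrite (expnS _ 7) leq_mul2l; apply/orP; right.
apply: (@leq_trans ((T * K) ^ 5)%N); last by rewrite leq_pexp2l.
by rewrite leq_exp2r// leq_pmulr.
Qed.

(** Since [ln T >= 1 / 2], the factor [ln T] lowers the logarithm by at most [ln 2], which is at
    most half of [ln (K T)] once [K T >= 4]. The rest is [(L - 1) ln 2 <= ln (K T)]. *)
Lemma bit_length_le : (2 <= K)%N ->
  L%:R <= 6 * ln (K%:R * T%:R * ln T%:R) :> R.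
Proof.
move=> K2; have Kp : (0 : R) < K%:R by rewrite ltr0n.
have Tp : (0 : R) < T%:R by rewrite ltr0n ltnW.
have ln2 : (1 : R) / 2 <= ln 2.
  have := @le_ln1Dx R (- (1 / 2)); rewrite (_ : 1 + _ = 2^-1); last by lra.
  by rewrite lnV ?posrE//; lra.
have lnT : (1 : R) / 2 <= ln T%:R.
  by apply: (le_trans ln2); rewrite ler_ln ?posrE ?ltr0n ?ler_nat// ltnW.
pose x : R := K%:R * T%:R.
have x4 : 4 <= x by rewrite /x -natrM ler_nat; nia.
have x0 : 0 < x by lra.
have lnx : 2 * ln 2 <= ln x.
  rewrite mulr_natl -lnXn// ler_ln ?posrE ?exprn_gt0//.
  by rewrite (_ : 2 ^+ 2 = 4) // -natrX.
have lny : ln x - ln 2 <= ln (x * ln T%:R).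
  rewrite -ln_div ?posrE// ler_ln ?posrE ?divr_gt0 ?mulr_gt0//; last by lra.
  by rewrite ler_wpM2l ?(ltW x0)//; lra.
have lnL : L.-1%:R * ln 2 <= ln x.
  rewrite mulr_natl -lnXn// ler_ln ?posrE ?exprn_gt0// -natrX /x -natrM ler_nat.
  by rewrite [(K * T)%N]mulnC /L bit_lengthP// ltnW.
have L0 : (0 : R) <= L.-1%:R by [].
apply: (@le_trans _ _ (1 + L.-1%:R)); first by rewrite nat1r.
by rewrite -/x; nra.
Qed.

Hypothesis rho01 : 0 < rho <= 1.

Lemma accuracy_ge : rho^-1 <= M%:R.
Proof.
have /andP[r0 _] := rho01; have := @accuracyP R rho M r0.
by rewrite ltnn => /negbT; rewrite -ltNge -ltr_pdivrMr// div1r => /ltW.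
Qed.

Lemma accuracy_le : M%:R <= 2 / rho.
Proof.
have /andP[r0 r1] := rho01.
have : M%:R <= 1 + rho^-1 :> R.
  by rewrite /M /accuracy -natr1 addrC lerD2l truncn_le// invr_ge0 ltW.
by have : 1 <= rho^-1 by [rewrite invr_ge1// unitfE gt_eqF]; lra.
Qed.

(** [N] is at least [1 / rho], so as soon as a window fits, the failure bound for the regret also
    serves replicability. *)
Lemma inv_horizon_le : (N <= T)%N -> 1 / (4 * T%:R) <= rho / 4.
Proof.
move=> NT; have /andP[r0 r1] := rho01.
have T0 : (0 : R) < T%:R by rewrite ltr0n ltnW.
have : rho^-1 <= T%:R.
  apply: (le_trans accuracy_ge); rewrite ler_nat; apply: leq_trans NT.
  have M1 : (0 < M)%N by []. have L1 : (0 < L)%N by [].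
  rewrite /N /sample_size -/M -/L -!mulnA leq_pmulr// !muln_gt0 K0 M1 L1//.
rewrite -[rho^-1]div1r ler_pdivrMr// => h.
by rewrite ler_pdivrMr ?mulr_gt0//; lra.
Qed.

End Constants.

(** * Probabilities of the exceptional events *)

Section BadEvents.
Context {R : realType} {K : nat} (T : nat) (rho : R).
Hypothesis T2 : (2 <= T)%N.
Hypothesis K0 : (0 < K)%N.
Hypothesis rho01 : 0 < rho <= 1.
Context (D : 'I_K -> probability R R) {d} {Om : measurableType d}
  (P : probability Om R) (E : eqType) (xi : nat -> {RV P >-> R})
  (X : E -> nat -> 'I_K -> {RV P >-> R}).
Hypothesis D01 : supported01 D.
Hypothesis model : bandit_model D xi X.

Let N := sample_size T K rho.
Let L := bit_length T K.
Local Notation W := (sample_deviation T K rho).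

Definition deviant_window e t0 i a : set Om :=
  [set w | W * 2 ^+ i < `|\sum_(t <- iota t0 (pulls N i)) X e t a w -
                          (pulls N i)%:R * mean D a|].

Lemma measurable_deviant_window e t0 i a : measurable (deviant_window e t0 i a).
Proof.
apply: measurable_set_ltr => //; apply: measurableT_comp => //.
by apply: measurable_funB => //; apply: measurable_sum.
Qed.

Lemma probability_deviant_window e t0 i a :
  (P (deviant_window e t0 i a) <= (2 * expR (- (8 * L%:R)))%:E)%E.
Proof.
have [_ HX ind] := model.
pose l : seq (nat + E * nat * 'I_K) := [seq inr (e, t, a) | t <- iota t0 (pulls N i)].
have sl : size l = pulls N i by rewrite size_map size_iota.
have := @hoeffding_tail _ _ _ P _ _ (D a) l ind (D01 a) _ _ (W * 2 ^+ i).
rewrite sl hoeffding_exponent// => tail.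
have -> : deviant_window e t0 i a = [set w | W * 2 ^+ i <
    `|\sum_(j <- l) match j with inl n => xi n | inr (e, t, a) => X e t a end w -
      (pulls N i)%:R * \int[D a]_x x|].
  by apply/funext => w; rewrite /deviant_window /= /l big_map.
apply: tail.
- by move=> j B /mapP[t _ ->] mB; exact: HX.
- by rewrite map_inj_uniq ?iota_uniq// => t t' [].
- have W0 : 0 <= W by rewrite /sample_deviation ler0n.
  rewrite mulr_ge0 ?exprn_ge0//= /pulls natrM natrX.
  have WN : 2 * W <= N%:R by exact: deviation_le.
  apply: (@le_trans _ _ (N%:R * 4%:R ^+ i)); last first.
    by rewrite ler_peMl ?ler1n// mulr_ge0 ?exprn_ge0.
  apply: ler_pM; [exact: W0|exact: exprn_ge0|by lra|].
  by rewrite lerXn2r ?nnegrE ?ler_nat.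
Qed.

(** The bound [1 / (4 T)] is for the regret, [rho / 4] for replicability. If [N > T] no window fits
    and the empty event will do. *)
Lemma good_windows_likely e : exists B : set Om,
  [/\ measurable B,
      forall w, ~ B w -> good_windows N (fun t a => X e t a w) (mean D) W T,
      (P B <= (1 / (4 * T%:R))%:E)%E & (P B <= (rho / 4)%:E)%E].
Proof.
pose I := ('I_T * 'I_T * 'I_K)%type.
pose F (j : I) : set Om := let: (t0, i, a) := j in
  if (pulls N i <= T)%N then deviant_window e t0 i a else set0.
have mF j : measurable (F j).
  by case: j => [[t0 i] a] /=; case: ifP => // _; exact: measurable_deviant_window.
pose B := \big[setU/set0]_(j <- enum {: I}) F j.
have BF j w : F j w -> B w.
  move=> Fw; rewrite /B -bigcup_seq; exists j => //=.
  by rewrite mem_enum.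
have good w : ~ B w -> good_windows N (fun t a => X e t a w) (mean D) W T.
  move=> nBw t0 i a t0T iT; rewrite leNgt; apply/negP => dev; apply: nBw.
  (* Windows that fit have [i < 4 ^ i <= T], which makes the union finite. *)
  have i_lt : (i < T)%N.
    apply: leq_trans iT; apply: leq_trans (ltn_expl i (isT : 1 < 4)%N) _.
    by rewrite leq_pmull// sample_size_gt0.
  by apply: (BF (Ordinal t0T, Ordinal i_lt, a)); rewrite /F /= iT.
have T0 : (0 : R) < T%:R by rewrite ltr0n ltnW.
have [NT|TN] := leqP N T.
  have PF j : (P (F j) <= (2 * expR (- (8 * L%:R)))%:E)%E.
    case: j => [[t0 i] a] /=; case: ifP => _; first exact: probability_deviant_window.
    by rewrite measure0 lee_fin mulr_ge0// expR_ge0.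
  have [mB PB] := measure_bigsetU_le (enum {: I}) mF PF.
  have PBT : (P B <= (1 / (4 * T%:R))%:E)%E.
    apply: (le_trans PB); rewrite lee_fin -cardE !card_prod !card_ord.
    exact: expR_bit_length.
  exists B; split => //; apply: (le_trans PBT).
  by rewrite lee_fin; exact: inv_horizon_le NT.
exists set0; rewrite measure0; split => //.
- move=> w _; apply: good => Bw; move: Bw.
  rewrite /B -bigcup_seq => -[[[t0 i] a] _] /=; case: ifP => // iT _.
  have := leq_trans TN (leq_trans _ iT); rewrite leq_pmulr ?expn_gt0// => /(_ isT).
  by rewrite ltnn.
- by rewrite lee_fin divr_ge0//; have /andP[/ltW] := rho01.
Qed.

Lemma probability_draw_itv (c h : R) : 0 <= h ->
  (P (xi 0%N @^-1` `[(c - h)%R, (c + h)%R]) <= (2 * h)%:E)%E.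
Proof.
move=> h0; have [Hxi _ _] := model; have := Hxi 0%N `[c - h, c + h]%classic.
rewrite /distribution /pushforward /= => -> //.
rewrite /uniform_prob.
apply: (@le_trans _ _ (\int[lebesgue_measure]_(x in `[(c - h)%R, (c + h)%R]) 1))%E.
  apply: ge0_le_integral => //=.
  - by move=> x _; rewrite lee_fin uniform_pdf_ge0.
  - apply/measurable_EFinP; apply: measurable_funTS; exact: measurable_uniform_pdf.
  - move=> x _; rewrite lee_fin /uniform_pdf subr0 invr1; case: ifP => // _.
rewrite integral_cst//= mul1e lebesgue_measure_itv/= lte_fin.
case: ifP => _; last by rewrite lee_fin mulr_ge0.
by rewrite -EFinD lee_fin; lra.
Qed.

Lemma probability_draw01 : P (xi 0%N @^-1` (~` `[0, 1])) = 0%E.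
Proof.
have [Hxi _ _] := model; have := Hxi 0%N (~` `[0, 1]%classic).
rewrite /distribution /pushforward /= => ->; last exact: measurableC.
rewrite /uniform_prob integral_uniform_pdf.
by rewrite setIC setICr integral_set0.
Qed.

End BadEvents.

Section Gaps.
Context {R : realType} {K : nat} (D : 'I_K -> probability R R).
Hypothesis D01 : supported01 D.

Lemma mean01 a : 0 <= mean D a <= 1.
Proof. exact: mean_supported01 (D01 a). Qed.

Lemma best_arm (a0 : 'I_K) : exists b : 'I_K,
  [/\ forall a, mean D a <= mean D b, best_mean D = mean D b &
      forall a, gap D a = mean D b - mean D a].
Proof.
case: (@arg_maxP _ _ _ a0 xpredT (mean D) isT) => b _ bmax.
have best : best_mean D = mean D b.
  apply/eqP; rewrite eq_le; apply/andP; split; last exact: le_bigmax.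
  apply/bigmax_leP; split=> [|a _]; first by have /andP[] := mean01 b.
  exact: bmax.
exists b; split=> // [a|a]; first exact: bmax.
by rewrite /gap best.
Qed.

End Gaps.

Section Separation.
Context {R : realType}.

(* The thresholds of successive batches double, so at most two consecutive
   batches can have a threshold close to a given gap. *)
Lemma critical_batches (g h : R) : 0 <= g -> 0 < h <= 1 / 8 ->
  exists i0 : nat, forall i u, 0 <= u <= 1 -> `|1 + u - 2 ^+ i * g| <= h ->
    i = i0 \/ i = i0.+1.
Proof.
move=> g0 /andP[h0 h8].
have [ex|nex] := pselect (exists i : nat, 1 - h <= 2 ^+ i * g); last first.
  exists 0%N => i u u01; rewrite ler_norml => iu; case: nex; exists i; lra.
have [i0 hi0 mini] := ex_minnP ex.
exists i0 => i u u01; rewrite ler_norml => iu.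
have i0i : (i0 <= i)%N by apply: mini; lra.
have [i2|] := leqP i i0.+1.
  by have [->|ne] := eqVneq i i0; [left|right; lia].
(* Two batches after [i0] the scaled gap is at least [4 * (1 - h)], which exceeds the largest
   possible value [2 + h]. *)
move=> i2; exfalso.
have : 4 * 2 ^+ i0 <= 2 ^+ i :> R.
  rewrite (_ : 4 = 2 ^+ 2); last by rewrite -natrX.
  by rewrite -exprD; apply: ler_weXn2l; [rewrite ler1n|lia].
move=> le4; have := ler_wpM2r g0 le4; lra.
Qed.

End Separation.

Section Replicability.
Context {R : realType} {K : nat} (T : nat) (rho : R).
Hypothesis T2 : (2 <= T)%N.
Hypothesis K0 : (0 < K)%N.
Hypothesis rho01 : 0 < rho <= 1.
Context (D : 'I_K -> probability R R).
Hypothesis D01 : supported01 D.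

Let N := sample_size T K rho.
Let M := accuracy rho.
Local Notation W := (sample_deviation T K rho).

Lemma thresholds_avoid_gaps {d} {Om : measurableType d} (P : probability Om R) (E : eqType)
    (xi : nat -> {RV P >-> R}) (X : E -> nat -> 'I_K -> {RV P >-> R}) :
  bandit_model D xi X ->
  exists V : set Om, [/\ measurable V,
    forall w i a, ~ V w -> 0 <= xi 0%N w <= 1 -> 2 * W * 2 ^+ i <
     `|threshold N i (xi 0%N w) - (pulls N i)%:R * gap D a| &
    (P V <= (rho / 2)%:E)%E].
Proof.
(* [N * h = 2 * W], so [h] is the margin after division by [N * 2 ^+ i]. Two intervals of length
   [2 * h] per arm give [4 * h * K = 1 / (2 * M) <= rho / 2]. *)
move=> model; pose h : R := 1 / (8 * (M * K)%:R).
have MK1 : (1 : R) <= (M * K)%:R by rewrite ler1n muln_gt0 K0.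
have h0 : 0 < h by rewrite divr_gt0// mulr_gt0//; lra.
have h8 : h <= 1 / 8 by rewrite ler_pdivrMr ?mulr_gt0//; lra.
have gap0 a : 0 <= gap D a.
  have [b [bmax _ gE]] := best_arm D01 (Ordinal K0).
  by rewrite gE subr_ge0 bmax.
have h08 : 0 < h <= 1 / 8 by rewrite h0.
have [i0 i0P] := choice (fun a => critical_batches (gap0 a) h08).
pose I i a : set Om := xi 0%N @^-1` `[(2 ^+ i * gap D a - 1 - h)%R,
                                      (2 ^+ i * gap D a - 1 + h)%R].
have mI i a : measurable (I i a).
  by rewrite -[I i a]setTI; apply: measurable_funPT.
have PI i a : (P (I i a) <= (2 * h)%:E)%E.
  exact: (probability_draw_itv model _ (ltW h0)).
pose F a := I (i0 a) a `|` I (i0 a).+1 a.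
have mF a : measurable (F a) by exact: measurableU.
have PF a : (P (F a) <= (4 * h)%:E)%E.
  apply: (le_trans (measureU2 _ (mI _ _) (mI _ _))).
  have -> : 4 * h = 2 * h + 2 * h by lra.
  by rewrite EFinD; apply: leeD; exact: PI.
have [mV PV] := measure_bigsetU_le (enum 'I_K) mF PF.
exists (\big[setU/set0]_(a <- enum 'I_K) F a); split => //.
  move=> w i a nV u01; rewrite ltNge; apply/negP => close; apply: nV.
  rewrite -bigcup_seq; exists a; first by rewrite /= mem_enum.
  have x0 : (0 : R) < 2 ^+ i by rewrite exprn_gt0.
  have N0 : (0 : R) < N%:R by rewrite ltr0n sample_size_gt0.
  have {close} close : `|1 + xi 0%N w - 2 ^+ i * gap D a| <= h.
    move: close; rewrite /threshold /pulls !(natrM _ N) !natrX.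
    have -> : (4%:R : R) ^+ i = 2 ^+ i * 2 ^+ i by rewrite -exprMn -natrM.
    rewrite [X in `|X|](_ : _ = N%:R * 2 ^+ i * (1 + xi 0%N w - 2 ^+ i * gap D a)); last by ring.
    rewrite normrM gtr0_norm ?mulr_gt0// => close.
    rewrite -(ler_pM2l (mulr_gt0 N0 x0)) (le_trans close)//.
    rewrite (_ : N%:R * 2 ^+ i * h = 2 * W * 2 ^+ i)// sample_size_deviation /h.
    by field; rewrite !pnatr_eq0 -!lt0n K0.
  have inI j : i = j -> I j a w.
    by move=> <-; rewrite /I /= in_itv/=; move: close; rewrite ler_norml; lra.
  by case: (i0P a i _ u01 close) => [/inI|/inI]; [left|right].
apply: (le_trans PV); rewrite lee_fin size_enum_ord.
have := accuracy_ge rho01; rewrite -/M => rM.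
have /andP[r0 _] := rho01.
have M0 : (0 : R) < M%:R by rewrite ltr0n.
have Kp : (0 : R) < K%:R by rewrite ltr0n.
rewrite (_ : _ * _ = (2 * M%:R)^-1); last first.
  by rewrite /h natrM; field; rewrite !gt_eqF.
rewrite invfM mulrC ler_wpM2r//.
by rewrite -[rho]invrK lef_pV2 ?posrE ?invr_gt0.
Qed.

(** The draw may leave [0, 1] on a null event, which must be removed because executions are analysed
    pointwise. *)
Lemma draw01_likely {d} {Om : measurableType d} (P : probability Om R) (E : eqType)
    (xi : nat -> {RV P >-> R}) (X : E -> nat -> 'I_K -> {RV P >-> R}) :
  bandit_model D xi X ->
  exists U : set Om, [/\ measurable U, forall w, ~ U w -> 0 <= xi 0%N w <= 1 &
    P U = 0%E].
Proof.
move=> model; exists (xi 0%N @^-1` (~` `[0, 1])); split.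
- by rewrite -[X in measurable X]setTI; apply: measurable_funPT => //; exact: measurableC.
- by move=> w; rewrite /= in_itv/= => /contrapT.
- exact: probability_draw01 model.
Qed.

Lemma elimination_replicable_model {d} {Om : measurableType d}
    (P : probability Om R) (xi : nat -> {RV P >-> R})
    (X : bool -> nat -> 'I_K -> {RV P >-> R}) :
  bandit_model D xi X ->
  ((1 - rho)%:E <=
   P [set w | arms (elimination N (Ordinal K0))
                (fun t a => X false t a w) (fun n => xi n w) T =
              arms (elimination N (Ordinal K0))
                (fun t a => X true t a w) (fun n => xi n w) T])%E.
Proof.
move=> model; set G := [set w | _].
have [V [mV HV PV]] := thresholds_avoid_gaps model.
have [U [mU HU PU]] := draw01_likely model.
have PU0 : (P U <= 0)%E by rewrite PU.
have [B1 [mB1 HB1 _ PB1]] := good_windows_likely T2 K0 rho01 D01 model false.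
have [B2 [mB2 HB2 _ PB2]] := good_windows_likely T2 K0 rho01 D01 model true.
have [b [bmax _ gE]] := best_arm D01 (Ordinal K0).
have mG : measurable G.
  pose A e w := arms (elimination N (Ordinal K0))
                (fun t a => X e t a w) (fun n => xi n w) T.
  have mA e : measurable_fibers (A e) by exact: measurable_arms.
  have /(_ true) : measurable_fibers (fun w => A true w == A false w).
    apply: (@measurable_fibers_bind _ _ _ _ _ (fun l w => A true w == l) (mA false)).
    move=> l; apply: (@measurable_fibers_bind _ _ _ _ _ (fun l' _ => l' == l) (mA true)).
    by move=> l'; exact: measurable_fibers_cst.
  rewrite (_ : [set w | _] = G) //; apply/seteqP; split=> w /=.
    by move=> /eqP.
  by move=> Gw; apply/eqP; exact/esym.
pose Bad := V `|` U `|` (B1 `|` B2).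
have mBad : measurable Bad by do !apply: measurableU.
have PBad : (P Bad <= rho%:E)%E.
  apply: (le_trans (measureU2 _ (measurableU _ _ mV mU) (measurableU _ _ mB1 mB2))).
  rewrite (_ : rho%:E = (rho / 2)%:E + (rho / 2)%:E)%E; last by rewrite -EFinD; congr EFin; lra.
  apply: leeD.
    apply: (le_trans (measureU2 _ mV mU)); rewrite -[leRHS]adde0.
    by apply: leeD => //; exact: PU0.
  apply: (le_trans (measureU2 _ mB1 mB2)).
  rewrite (_ : (rho / 2)%:E = (rho / 4)%:E + (rho / 4)%:E)%E; last first.
    by rewrite -EFinD; congr EFin; lra.
  exact: leeD.
apply: (@le_trans _ _ (P (~` Bad))).
  by rewrite probability_setC// EFinB leeB.
apply: le_measure; [exact/mem_set/measurableC|exact/mem_set|].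
move=> w /= nBad.
have nV : ~ V w by move=> h; apply: nBad; left; left.
have nU : ~ U w by move=> h; apply: nBad; left; right.
have nB1 : ~ B1 w by move=> h; apply: nBad; right; left.
have nB2 : ~ B2 w by move=> h; apply: nBad; right; right.
apply: (@elimination_replicates _ _ _ _ b _ _ _ (mean D) W) => //.
- exact: sample_size_gt0.
- exact: mean01.
- exact: HU.
- exact: deviation_le.
- exact: HB1.
- exact: HB2.
- by move=> i a _; rewrite -gE; apply: HV => //; exact: HU.
Qed.

End Replicability.

(** * Expected regret *)

Section Regret.
Context {R : realType} {K : nat} (T : nat) (rho : R).
Hypothesis T2 : (2 <= T)%N.
Hypothesis K0 : (0 < K)%N.
Hypothesis rho01 : 0 < rho <= 1.
Context (D : 'I_K -> probability R R).
Hypothesis D01 : supported01 D.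
Context {d} {Om : measurableType d} (P : probability Om R).
Variables (xi : nat -> {RV P >-> R}) (X : nat -> 'I_K -> {RV P >-> R}).
Hypothesis model : bandit_model D xi (fun _ : unit => X).

Let N := sample_size T K rho.
Local Notation W := (sample_deviation T K rho).

Let pulled_arms w : seq 'I_K :=
  arms (elimination N (Ordinal K0)) (fun t a => X t a w) (fun n => xi n w) T.

Lemma size_arms (A : policy R K) (Y : nat -> 'I_K -> R) z t : size (arms A Y z t) = t.
Proof. by rewrite /arms size_map; elim: t => //= t IH; rewrite size_rcons IH. Qed.

Lemma sum_gap_arms (l : seq 'I_K) :
  (size l)%:R * best_mean D - \sum_(a <- l) mean D a =
  \sum_(j < K | 0 < gap D j) (count_mem j l)%:R * gap D j.
Proof.
have [b [bmax _ gE]] := best_arm D01 (Ordinal K0).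
have gap0 a : 0 <= gap D a by rewrite gE subr_ge0.
transitivity (\sum_(a <- l) gap D a).
  by rewrite sumrB big_const_seq count_predT iter_addr addr0 mulr_natl.
rewrite [RHS]big_mkcond /=.
elim: l => [|a l IH]; first by rewrite big_nil big1// => j _; rewrite mul0r if_same.
rewrite big_cons IH (bigD1 a)//= [in RHS](bigD1 a)//= eqxx add1n.
rewrite (eq_bigr (fun j => if 0 < gap D j then
    (count_mem j (a :: l))%:R * gap D j else 0)).
  rewrite addrA; congr (_ + _); case: ifP => ga; first by rewrite -natr1 mulrDl mul1r addrC.
  by rewrite addr0; apply/eqP; rewrite eq_le gap0 leNgt ga.
by move=> j ja; rewrite /= eq_sym (negbTE ja) add0n.
Qed.

(** Off an event of probability at most [1 / (4 T)] the pull counts give the terms [48 N / g]. On it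
    the regret is at most [T] times the sum of the gaps, which costs a quarter of that sum in
    expectation. *)
Lemma expected_regret_le :
  (expected_regret D T (elimination N (Ordinal K0)) xi X <=
   (\sum_(j < K | 0 < gap D j) (gap D j + 48 * N%:R / gap D j))%:E)%E.
Proof.
have [U [mU HU PU]] := draw01_likely model.
have PU0 : (P U <= 0)%E by rewrite PU.
have [B [mB HB PB _]] := good_windows_likely T2 K0 rho01 D01 model tt.
have [b [bmax bestE gE]] := best_arm D01 (Ordinal K0).
pose f w := \sum_(a <- pulled_arms w) mean D a.
pose Gam := \sum_(j < K | 0 < gap D j) gap D j.
pose G := \sum_(j < K | 0 < gap D j) 48 * N%:R / gap D j.
have Gam0 : 0 <= Gam by apply: sumr_ge0 => j /ltW.
have G0 : 0 <= G by apply: sumr_ge0 => j /ltW gj; rewrite divr_ge0// mulr_ge0.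
have f0 w : 0 <= f w by apply: sumr_ge0 => a _; have /andP[] := mean01 D01 a.
have mf : measurable_fun setT f.
  move=> _ Y mY; rewrite setTI.
  have mA : measurable_fibers pulled_arms by exact: (measurable_arms (X := X) (xi := xi)).
  have /(_ true) := @measurable_fibers_bind _ _ _ _ _
    (fun l _ => `[< Y (\sum_(a <- l) mean D a) >]) mA (fun l => measurable_fibers_cst _).
  by rewrite (_ : [set w | _] = f @^-1` Y)//; apply/seteqP; split=> w /asboolP.
pose Z := B `|` U.
have mZ : measurable Z by exact: measurableU.
have PZ : (P Z <= (1 / (4 * T%:R))%:E)%E.
  apply: (le_trans (measureU2 _ mB mU)); rewrite -[leRHS]adde0.
  by apply: leeD => //; exact: PU0.
have key w : T%:R * best_mean D <= f w + (G + T%:R * Gam * \1_Z w).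
  have := sum_gap_arms (pulled_arms w); rewrite size_arms -/(f w) => fE.
  rewrite -lerBlDl fE indicE.
  have [/set_mem Zw|nZ] := boolP (w \in Z).
    rewrite mulr1 (le_trans (_ : _ <= T%:R * Gam)) ?lerDr//.
    rewrite mulr_sumr; apply: ler_sum => j /ltW gj; apply: ler_wpM2r => //.
    by rewrite ler_nat -[leqRHS](size_arms (elimination N (Ordinal K0))
      (fun t a => X t a w) (fun n => xi n w)) count_size.
  have {}nZ : ~ Z w by move=> h; move: nZ; rewrite mem_set.
  have nB : ~ B w by move=> h; apply: nZ; left.
  have nU : ~ U w by move=> h; apply: nZ; right.
  rewrite mulr0 addr0; apply: ler_sum => j gj.
  rewrite ler_pdivlMr// -mulrA -expr2 gE /pulled_arms.
  case St : (batch N (history (elimination_policy N (Ordinal K0))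
     (fun t a => X t a w) (fun n => xi n w) T) (xi 0%N w) T) => [[i s] t0].
  have N0 : (0 < N)%N by exact: sample_size_gt0.
  have W2 : 2 * W <= N%:R by exact: deviation_le.
  have [_] := count_pulls N0 (mean01 D01) bmax (HU w nU) W2 (HB w nB) j (leqnn T) St.
  exact.
have Ef : ((T%:R * best_mean D)%:E <= 'E_P[f] + (G + Gam)%:E)%E.
  apply: (@le_trans _ _ (\int[P]_w (f w + (G + T%:R * Gam * \1_Z w))%:E)%E).
    rewrite -[leLHS]mule1 -(@probability_setT _ _ _ P) -integral_cst//.
    apply: ge0_le_integral => //.
    - move=> w _; rewrite lee_fin mulr_ge0// bestE.
      by have /andP[] := mean01 D01 b.
    - apply/measurable_EFinP; apply: measurable_funD => //.
      apply: measurable_funD => //; exact: measurable_funM.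
    - by move=> w _; rewrite lee_fin.
  under eq_integral do rewrite EFinD.
  rewrite ge0_integralD//; last 4 first.
  - by move=> w _; rewrite lee_fin.
  - exact/measurable_EFinP.
  - by move=> w _; rewrite lee_fin addr_ge0// !mulr_ge0.
  - apply/measurable_EFinP; apply: measurable_funD => //; exact: measurable_funM.
  rewrite unlock leeD2l//.
  under eq_integral do rewrite EFinD EFinM.
  rewrite ge0_integralD//; last 2 first.
  - by move=> w _; rewrite -EFinM lee_fin !mulr_ge0.
  - apply/measurable_EFinP; exact: measurable_funM.
  have -> : (\int[P]_w G%:E = G%:E)%E.
    by have := @expectation_cst _ _ _ P G; rewrite unlock.
  rewrite EFinD leeD2l//.
  rewrite ge0_integralZl//; last 2 first.
  - exact/measurable_EFinP.
  - by rewrite lee_fin mulr_ge0.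
  rewrite integral_indic// setIT.
  apply: (le_trans (lee_wpmul2l _ PZ)); first by rewrite lee_fin mulr_ge0.
  have T0 : (0 : R) < T%:R by rewrite ltr0n ltnW.
  rewrite -EFinM lee_fin [leLHS](_ : _ = Gam / 4); last by field; rewrite gt_eqF.
  by lra.
rewrite /expected_regret -/f big_split /= -/Gam -/G addrC.
(* An expectation [+oo] would make the regret [-oo], and [-oo] contradicts [Ef]. *)
move: Ef; case: ('E_P[f])%E => [r| |] //=.
  by rewrite -!EFinD !lee_fin; lra.
by rewrite addeNy leNye.
Qed.

End Regret.

(** 48 comes from the pull counts, 16384 from the sample size, and [24 = 4 * 6] from
    [(M K) ^ 2 <= 4 K^2 / rho^2] and [bit_length_le]. *)
Definition regret_constant {R : realType} : R := 48 * (16384 * 24).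

Lemma regret_term_le {R : realType} (T K : nat) (rho g : R) :
  (2 <= T)%N -> (2 <= K)%N -> 0 < rho <= 1 -> 0 < g ->
  g + 48 * (sample_size T K rho)%:R / g <=
  regret_constant * (K%:R ^+ 2 / rho ^+ 2) *
  (g + ln (K%:R * T%:R * ln T%:R) / g).
Proof.
move=> T2 K2 rho01 g0; have /andP[r0 r1] := rho01.
set y := ln _; set q := K%:R ^+ 2 / rho ^+ 2.
have q1 : 1 <= q.
  rewrite ler_pdivlMr ?exprn_gt0// mul1r lerXn2r ?nnegrE ?(ltW r0)//.
  by rewrite (le_trans r1)// ler1n ltnW.
have Ly : (bit_length T K)%:R <= 6 * y by apply: bit_length_le => //; exact: ltnW.
have L0 : (0 : R) <= (bit_length T K)%:R by [].
have Mq : ((accuracy rho)%:R * K%:R) ^+ 2 <= 4 * q.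
  rewrite (_ : 4 * q = (2 / rho * K%:R) ^+ 2); last by rewrite /q; field; rewrite gt_eqF.
  rewrite lerXn2r ?nnegrE ?mulr_ge0 ?invr_ge0 ?(ltW r0)//.
  by rewrite ler_wpM2r// accuracy_le.
have NE : (sample_size T K rho)%:R =
    16384 * (((accuracy rho)%:R * K%:R) ^+ 2 * (bit_length T K)%:R) :> R.
  by rewrite /sample_size !natrM; ring.
have Nq : (sample_size T K rho)%:R <= 16384 * 24 * q * y.
  have := ler_pM (sqr_ge0 _) L0 Mq Ly.
  by rewrite NE; set s := _ ^+ 2 * _ => h; lra.
rewrite mulrDr lerD//.
  by rewrite ler_peMl ?(ltW g0)// /regret_constant; lra.
rewrite mulrA ler_pM2r ?invr_gt0//.
by rewrite /regret_constant; lra.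
Qed.

Theorem theorem4 (R : realType) :
  exists (C : R)
         (A : forall (T K : nat) (rho : R), (0 < K)%N -> bandit_algorithm R K)
         (prog : program) (c e : nat),
    0 < C /\
    forall (T K : nat) (rho : R) (hK : (0 < K)%N),
      (2 <= T)%N -> 0 < rho <= 1 ->
      [/\ replicable T rho (A T K rho hK),
          forall D : 'I_K -> probability R R, supported01 D ->
            regret_at_most D T (A T K rho hK)
              (C * (K%:R ^+ 2 / rho ^+ 2) *
               \sum_(j < K | 0 < gap D j)
                 (gap D j + ln (K%:R * T%:R * ln T%:R) / gap D j))
        & implements_within T rho prog (A T K rho hK)
            (c%:R * (K%:R * T%:R / rho) ^+ e)].
Proof.
exists regret_constant, (fun T K rho hK => elimination (sample_size T K rho) (Ordinal hK)).
exists main_program, 300%N, 1%N; split; first by rewrite /regret_constant; lra.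
move=> T K rho hK T2 rho01; split.
- by move=> D D01 d Om P xi X model; exact: elimination_replicable_model.
- move=> D D01 d Om P xi X model.
  apply: (le_trans (expected_regret_le T2 hK rho01 D01 model)).
  rewrite lee_fin mulr_sumr; apply: ler_sum => j gj.
  apply: regret_term_le => //; rewrite ltn_neqAle hK andbT.
  (* A single arm is the best one and has gap 0, so terms of the sum occur for [K >= 2] only. *)
  apply: contraTneq gj => K1; have [b [_ _ ->]] := best_arm D01 j.
  have -> : b = j by apply: ord_inj; have := ltn_ord b; have := ltn_ord j; lia.
  by rewrite subrr ltxx.
- by apply: main_program_implements => //; exact: ltnW.
Qed.
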